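(* Let $D\subseteq\mathcal{M}(R_1)$ be an open connected free set and let $u:D\to\mathcal{M}(R_2)$ be a pluriharmonic real free function. Then $u$ has a pluriharmonic conjugate, i.e. there is an analytic free function $f$ on $D$ such that $u=\mathrm{Re}\, f$ on $D$.
   Context: For a topological vector space $R$ over $\mathbb{C}$, the matrix universe is $\mathcal{M}(R)=\bigcup_{n\ge1}M_n(\mathbb{C})\otimes R$. A free set $D\subseteq\mathcal{M}(R)$ is a set closed under direct sums ($X,Y\in D\Rightarrow X\oplus Y\in D$) and unitary conjugation ($X\in D$, $V$ unitary of matching size $\Rightarrow V^*XV\in D$). Write $D_n=D\cap (M_n(\mathbb{C})\otimes R)$. $D$ is open if each $D_n$ is open, and connected if each $D_n$ is path connected. A real free function $f:D\to\mathcal{M}(R_2)$ satisfies $f(D_n)\subseteq\mathcal{M}(R_2)_n$, $f(X\oplus Y)=f(X)\oplus f(Y)$, and $f(V^*XV)=V^*f(X)V$ for $V$ unitary. It is analytic if each restriction $f|_{D_n}$ is analytic. Here $R_2$ is a subspace of an operator algebra. A self-adjoint-valued real free function $u$ on $D$ is pluriharmonic if it is pluriharmonic at each level, that is, $\Delta u(Z)[H]=0$ for all $Z \in D$ and all directions $H$, where $\Delta u(Z)[H]=\frac{\partial}{\partial\overline z}\frac{\partial}{\partial z}u(Z+zH)\big|_{z=0}$, $z\in\mathbb{C}$. $\mathrm{Re}\,A=(A+A^* )/2$.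
   Formalization: Pluriharmonic functions are assumed C² at each level (derivatives jointly continuous in point and directions), as a discontinuous linear functional is otherwise a counterexample; the conjugate f, whose codomain the English leaves open, takes values in matrices over the closure of R_2. *)

(* Defs.v *)
From HB Require Import structures.
From mathcomp Require Import all_boot all_order all_algebra.
From mathcomp Require Import all_classical all_reals all_analysis.
From mathcomp Require Import complex.

Set Implicit Arguments.
Unset Strict Implicit.
Unset Printing Implicit Defensive.

Import Order.TTheory GRing.Theory Num.Theory.
Import numFieldNormedType.Exports.

Local Open Scope classical_set_scope.
Local Open Scope complex_scope.
Local Open Scope sesquilinear_scope.
Local Open Scope ring_scope.

(* M_n(C) (x) E, realized as n x n matrices with entries in E. The library makes
   'M[E]_n a left module over E only, when E is a ring; this alias is a
   topological vector space over the scalars of E. *)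
Definition tensmx (E : Type) (n : nat) : Type := 'M[E]_n.

Section TensMx.
Context {K : numFieldType}.

Section Lmod.
Variables (E : lmodType K) (n : nat).
HB.instance Definition _ := GRing.Zmodule.copy (tensmx E n) 'M[E]_n.

Definition tensmx_scale (c : K) (X : tensmx E n) : tensmx E n :=
  map_mx ( *:%R c) X.

Fact tensmx_scaleA a b (X : tensmx E n) :
  tensmx_scale a (tensmx_scale b X) = tensmx_scale (a * b) X.
Proof. by apply/matrixP => i j; rewrite !mxE scalerA. Qed.

Fact tensmx_scale1 : left_id 1 tensmx_scale.
Proof. by move=> X; apply/matrixP => i j; rewrite !mxE scale1r. Qed.

Fact tensmx_scaleDr : right_distributive tensmx_scale +%R.
Proof. by move=> c X Y; apply/matrixP => i j; rewrite !mxE scalerDr. Qed.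

Fact tensmx_scaleDl X : {morph tensmx_scale^~ X : a b / a + b}.
Proof. by move=> a b; apply/matrixP => i j; rewrite !mxE scalerDl. Qed.

HB.instance Definition _ := GRing.Zmodule_isLmodule.Build K (tensmx E n)
  tensmx_scaleA tensmx_scale1 tensmx_scaleDr tensmx_scaleDl.
End Lmod.

Section Top.
Variables (E : topologicalLmodType K) (n : nat).
HB.instance Definition _ := Topological.copy (tensmx E n) 'M[E]_n.

Fact tensmx_add_continuous :
  continuous (fun p : tensmx E n * tensmx E n => p.1 + p.2).
Proof.
move=> [X Y] S /= [P nP PS].
have H i j : \forall p \near (X i j, Y i j), P i j (p.1 + p.2).
  by apply: (@add_continuous E (X i j, Y i j)); have := nP i j; rewrite mxE.
pose Q i j := (sval (cid2 (H i j))).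
have Qn i j : nbhs (X i j) (Q i j).1 /\ nbhs (Y i j) (Q i j).2.
  by rewrite /Q; case: cid2.
exists ([set M : 'M[E]_n | forall i j, (Q i j).1 (M i j)],
        [set M : 'M[E]_n | forall i j, (Q i j).2 (M i j)]).
  split.
    by exists (fun i j => (Q i j).1) => // i j; exact: (Qn i j).1.
  by exists (fun i j => (Q i j).2) => // i j; exact: (Qn i j).2.
move=> [M N] /= [MQ NQ]; apply: PS => i j; rewrite mxE.
have := MQ i j; have := NQ i j; rewrite /Q; case: cid2 => U /= _ US U2 U1.
exact: (US (M i j, N i j)).
Qed.

HB.instance Definition _ := PreTopologicalNmodule_isTopologicalNmodule.Build
  (tensmx E n) tensmx_add_continuous.

Fact tensmx_scale_continuous :
  continuous (fun z : K^o * tensmx E n => z.1 *: z.2).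
Proof.
move=> [c X] S /= [P nP PS].
have H i j : \forall p \near ((c : K^o), X i j), P i j (p.1 *: p.2).
  by apply: (@scale_continuous K E (c, X i j)); have := nP i j; rewrite mxE.
pose Q i j := (sval (cid2 (H i j))).
have Qn i j : nbhs (c : K^o) (Q i j).1 /\ nbhs (X i j) (Q i j).2.
  by rewrite /Q; case: cid2.
exists ([set d : K^o | forall i j, (Q i j).1 d],
        [set M : 'M[E]_n | forall i j, (Q i j).2 (M i j)]).
  split.
    have h : \forall d \near (c : K^o), forall i j, (Q i j).1 d.
      apply: (@filter_forall _ _ _ (nbhs (c : K^o))) => i.
      apply: (@filter_forall _ _ _ (nbhs (c : K^o))) => j.
      exact: (Qn i j).1.
    exact: h.
  by exists (fun i j => (Q i j).2) => // i j; exact: (Qn i j).2.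
move=> [d N] /= [dQ NQ]; apply: PS => i j; rewrite mxE.
have := dQ i j; have := NQ i j; rewrite /Q; case: cid2 => U /= _ US U2 U1.
exact: (US (d, N i j)).
Qed.

HB.instance Definition _ := TopologicalNmodule_isTopologicalLmodule.Build
  K (tensmx E n) tensmx_scale_continuous.
End Top.
End TensMx.

(* C*-algebras over R[i], not necessarily unital. *)
HB.mixin Record isCStarAlgebra (R : realType) (A : Type)
    of CompleteNormedModule (complex R) A := {
  cstar_mul : A -> A -> A;
  adj : A -> A;
  cstar_mulA : associative cstar_mul;
  cstar_mulDl : left_distributive cstar_mul +%R;
  cstar_mulDr : right_distributive cstar_mul +%R;
  cstar_mulZl : forall (c : complex R) (a b : A),
    cstar_mul (c *: a) b = c *: cstar_mul a b;
  cstar_mulZr : forall (c : complex R) (a b : A),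
    cstar_mul a (c *: b) = c *: cstar_mul a b;
  cstar_normM : forall a b : A, `|cstar_mul a b| <= `|a| * `|b|;
  adjK : involutive adj;
  adjD : {morph adj : a b / a + b};
  adjZ : forall (c : complex R) (a : A), adj (c *: a) = c^*%C *: adj a;
  adjM : forall a b : A, adj (cstar_mul a b) = cstar_mul (adj b) (adj a);
  cstar_normE : forall a : A, `|cstar_mul (adj a) a| = `|a| ^+ 2
}.

#[short(type="cstarAlgType")]
HB.structure Definition CStarAlgebra (R : realType) :=
  {A of isCStarAlgebra R A & CompleteNormedModule (complex R) A}.

Section OperatorAlgebras.
Context {R : realType} {A : cstarAlgType R}.

Definition subspace_of (S : set A) : Prop :=
  [/\ S 0, forall a b, S a -> S b -> S (a + b)
    & forall (c : R[i]) a, S a -> S (c *: a)].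

(* By the Gelfand-Naimark theorem, the norm-closed subalgebras of C*-algebras
   are the norm-closed subalgebras of the algebras B(H), H a Hilbert space. *)
Definition operator_algebra (B : set A) : Prop :=
  [/\ subspace_of B, forall a b, B a -> B b -> B (cstar_mul a b) & closed B].

Definition adjmx {n} (M : tensmx A n) : tensmx A n :=
  \matrix_(i, j) adj (M j i).

Definition selfadjoint {n} (M : tensmx A n) : Prop := adjmx M = M.

Definition Remx {n} (M : tensmx A n) : tensmx A n := 2^-1 *: (M + adjmx M).

End OperatorAlgebras.

Section MatrixUniverse.
Context {R : realType}.

Definition lactmx {E : lmodType R[i]} {n} (V : 'M[R[i]]_n) (X : tensmx E n) :
  tensmx E n := \matrix_(i, j) \sum_k V i k *: X k j.

Definition ractmx {E : lmodType R[i]} {n} (X : tensmx E n) (V : 'M[R[i]]_n) :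
  tensmx E n := \matrix_(i, j) \sum_k V k j *: X i k.

Definition unitary_conj {E : lmodType R[i]} {n} (V : 'M[R[i]]_n)
  (X : tensmx E n) : tensmx E n := ractmx (lactmx (V^t*) X) V.

Definition dsum {E : lmodType R[i]} {m n} (X : tensmx E m) (Y : tensmx E n) :
  tensmx E (m + n) := (block_mx X 0 0 Y : 'M[E]_(m + n)).

(* A subset D of the matrix universe is given by its levels D n, n >= 1;
   the value D 0 plays no role. *)
Definition free_set {E : lmodType R[i]} (D : forall n, set (tensmx E n)) : Prop :=
  (forall m n (X : tensmx E m) (Y : tensmx E n), (0 < m)%N -> (0 < n)%N ->
     D m X -> D n Y -> D (m + n)%N (dsum X Y)) /\
  (forall n (V : 'M[R[i]]_n) (X : tensmx E n), (0 < n)%N ->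
     V \is unitarymx -> D n X -> D n (unitary_conj V X)).

Definition free_open {E : topologicalLmodType R[i]}
    (D : forall n, set (tensmx E n)) : Prop :=
  forall n, (0 < n)%N -> open (D n).

Definition path_connected {T : topologicalType} (S : set T) : Prop :=
  forall x y, S x -> S y -> exists gamma : R -> T,
    [/\ {within `[0, 1], continuous gamma}, gamma 0 = x, gamma 1 = y
      & forall t, 0 <= t <= 1 -> S (gamma t)].

Definition free_connected {E : topologicalLmodType R[i]}
    (D : forall n, set (tensmx E n)) : Prop :=
  forall n, (0 < n)%N -> path_connected (D n).

Definition matrices_over {E : Type} (S : set E) n : set (tensmx E n) :=
  [set M | forall i j, S (M i j)].

(* Free functions are total functions of which only the values on D matter. *)
Definition real_free_function {E F : lmodType R[i]}
    (D : forall n, set (tensmx E n)) (S : set F)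
    (f : forall n, tensmx E n -> tensmx F n) : Prop :=
  [/\ forall n (X : tensmx E n), (0 < n)%N -> D n X -> matrices_over S (f n X),
      forall m n (X : tensmx E m) (Y : tensmx E n), (0 < m)%N -> (0 < n)%N ->
        D m X -> D n Y -> f (m + n)%N (dsum X Y) = dsum (f m X) (f n Y)
    & forall n (V : 'M[R[i]]_n) (X : tensmx E n), (0 < n)%N ->
        V \is unitarymx -> D n X ->
        f n (unitary_conj V X) = unitary_conj V (f n X)].

End MatrixUniverse.

Section Calculus.
Context {R : realType} {E F : topologicalLmodType R[i]}.

Definition cquot (f : E -> F) (x v : E) (z : R[i]^o) : F :=
  (z : R[i])^-1 *: (f (x + (z : R[i]) *: v) - f x).

Definition cderivable (f : E -> F) (x v : E) : Prop :=
  exists l : F, cquot f x v z @[z --> 0^'] --> l.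

(* Holomorphy for maps out of a topological vector space: continuity together
   with complex differentiability along every complex line. *)
Definition analytic_on (O : set E) (f : E -> F) : Prop :=
  forall x, O x -> {for x, continuous f} /\ forall v, cderivable f x v.

(* Directional derivatives along a real parameter; the library's derivable and
   'D_v would make the parameter range over the complex scalars. *)
Definition rquot (f : E -> F) (x v : E) (t : R) : F :=
  (t^-1)%:C *: (f (x + t%:C *: v) - f x).

Definition rderivable (f : E -> F) (x v : E) : Prop :=
  exists l : F, rquot f x v t @[t --> 0^'] --> l.

Definition rderive (f : E -> F) (x v : E) : F :=
  xget 0 [set l : F | rquot f x v t @[t --> 0^'] --> l].

Definition rderive2 (f : E -> F) (x v w : E) : F :=
  rderive (fun y => rderive f y v) x w.

(* Class C^2 in the usual sense for topological vector spaces: the directional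
   derivatives of order 1 and 2 exist and are jointly continuous in the point
   and the directions. In finite dimension this is ordinary C^2 regularity. *)
Definition C2_on (O : set E) (f : E -> F) : Prop :=
  [/\ forall x, O x -> {for x, continuous f},
      forall x v, O x -> rderivable f x v /\
        {for (x, v), continuous (fun p : E * E => rderive f p.1 p.2)}
    & forall x v w, O x -> rderivable (fun y => rderive f y v) x w /\
        {for (x, v, w), continuous
           (fun p : E * E * E => rderive2 f p.1.1 p.1.2 p.2)}].

End Calculus.

Section Pluriharmonic.
Context {R : realType}.

(* The Wirtinger derivatives d/dz and d/dzbar. *)
Definition dz {F : topologicalLmodType R[i]} (g : R[i]^o -> F) (z : R[i]^o) :
  F := 2^-1 *: (rderive g z 1 - 'i%C *: rderive g z 'i%C).

Definition dzbar {F : topologicalLmodType R[i]} (g : R[i]^o -> F)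
  (z : R[i]^o) : F := 2^-1 *: (rderive g z 1 + 'i%C *: rderive g z 'i%C).

Definition laplacian {E F : topologicalLmodType R[i]} (u : E -> F)
  (Z H : E) : F :=
  dzbar (dz (fun z : R[i]^o => u (Z + (z : R[i]) *: H))) 0.

Definition pluriharmonic_on {E F : topologicalLmodType R[i]} (O : set E)
    (u : E -> F) : Prop :=
  C2_on O u /\ forall Z H, O Z -> laplacian u Z H = 0.

Definition free_pluriharmonic {E : topologicalLmodType R[i]}
    {A : cstarAlgType R} (D : forall n, set (tensmx E n))
    (u : forall n, tensmx E n -> tensmx A n) : Prop :=
  forall n, (0 < n)%N ->
    (forall X, D n X -> selfadjoint (u n X)) /\ pluriharmonic_on (D n) (u n).

Definition free_analytic {E : topologicalLmodType R[i]}
    {A : cstarAlgType R} (D : forall n, set (tensmx E n))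
    (f : forall n, tensmx E n -> tensmx A n) : Prop :=
  forall n, (0 < n)%N -> analytic_on (D n) (f n).

End Pluriharmonic.

(* Main.v *)
(** If f is a free analytic function with Re f = u, then Df (Z) [[Z, K]] = [f Z, K]
    for every scalar matrix K, and Df is del u (Z) [H] = Du (Z) [H] - i Du (Z) [i H],
    twice the complex linear part of Du. So f can be read off from the
    first derivatives of u: fix X0 in D, let Z be the direct sum of X and X0 and o the
    first index of X0; then the (j, o) entry of delta (E_io), where
    delta (K) = del u (Z) [[Z, K]], is f(X)_ji - (i = j) f(X0)_oo. Taking this as the
    definition of f, with u(X0)_oo for f(X0)_oo, avoids integration along paths.
    Differentiating u (V^* Z V) = V^* u(Z) V along curves of unitaries gives
    Du (Z) [i [Z, H]] = i [u Z, H] for hermitian H. Therefore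
    delta (K) - delta (K^* )^* = 2 [u Z, K], and, after a second differentiation, delta
    is a Lie derivation, because the second derivative of a pluriharmonic function
    yields a symmetric complex bilinear map. A Lie derivation satisfies
    delta (E_oi)_oj = - delta (E_jo)_io for i and j distinct from o, and these two
    identities say that Re f = u. That f is free is inherited from u, and it is analytic
    since the derivative of del u is complex linear. *)

Require Import Defs.
From HB Require Import structures.
From mathcomp Require Import all_boot all_order all_algebra.
From mathcomp Require Import all_classical all_reals all_analysis.
From mathcomp Require Import complex ring lra.

Set Implicit Arguments.
Unset Strict Implicit.
Unset Printing Implicit Defensive.

Import Order.TTheory GRing.Theory Num.Theory.
Import numFieldNormedType.Exports.

Local Open Scope classical_set_scope.
Local Open Scope complex_scope.
Local Open Scope ring_scope.

(** * Differential calculus in topological vector spaces *)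

(** The commutators [[f Z, K]] determine a matrix only up to adding one element along the diagonal,
    and nothing relates these undetermined elements from one size to another. Placing the same [X0]
    next to every [X] and reading the block between the indices of [X] and [o] normalizes them all
    against one corner entry; this is what makes direct sums come out right. As [u(X0)_oo] is
    self-adjoint, choosing it only sets an imaginary part to zero. The obstacle is the real part:
    the adjoint identity at [E_io] involves an entry of [delta (E_oi)], whereas the adjoint of [f]
    is read off [delta (E_jo)]. For an inner derivation [[F, .]] these entries are opposite, but no
    such [F] is at hand yet; the Lie rule supplies the relation by computing with matrix units. The
    domain carries no norm, hence no Frechet derivative. All estimates are made in the target and
    along lines. Since [f] is built from derivatives of [u], its entries are limits of elements of
    [R2] and lie in the closure. *)

Section CompatibleNorm.
Context {R : realType}.

(** Matrices over [A] are given only the product topology, so the norm is a parameter tied to the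
    topology by the last clause. It takes values in [R], where the order is total; the modulus of
    [R[i]] is complex valued, whence [complex.Re]. *)
Definition compatible_norm {F : topologicalLmodType R[i]} (N : F -> R) : Prop :=
  [/\ forall a b, N (a + b) <= N a + N b,
      forall (z : R[i]) a, N (z *: a) = complex.Re `|z| * N a,
      forall a, N a = 0 -> a = 0
    & forall a (S : set F),
        nbhs a S <-> exists2 e : R, 0 < e & forall b, N (b - a) < e -> S b].

Context {F : topologicalLmodType R[i]} {N : F -> R}.
Hypothesis hN : compatible_norm N.

Lemma normD a b : N (a + b) <= N a + N b.
Proof. by case: hN. Qed.

Lemma normZ (z : R[i]) a : N (z *: a) = complex.Re `|z| * N a.
Proof. by case: hN. Qed.

Lemma normR_complex (t : R) : complex.Re `|t%:C| = `|t|.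
Proof. by rewrite normc_def /= expr0n addr0 sqrtr_sqr. Qed.

Lemma normRZ (t : R) a : N (t%:C *: a) = `|t| * N a.
Proof. by rewrite normZ normR_complex. Qed.

Lemma norm0 : N 0 = 0.
Proof. by rewrite -(scale0r (0 : F)) normZ normr0 mul0r. Qed.

Lemma normN a : N (- a) = N a.
Proof. by rewrite -scaleN1r normZ normrN1 mul1r. Qed.

Lemma norm_ge0 a : 0 <= N a.
Proof. by have := normD a (- a); rewrite subrr norm0 normN; lra. Qed.

Lemma norm_eq0 a : N a = 0 -> a = 0.
Proof. by case: hN => _ _ + _; exact. Qed.

Lemma norm_le_eq0 a : (forall e : R, 0 < e -> N a <= e) -> a = 0.
Proof.
move=> h; apply: norm_eq0; apply/eqP; rewrite eq_le norm_ge0 andbT.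
by apply/ler_addgt0Pr => e e0; rewrite add0r h.
Qed.

Lemma normB_le a b c : N (a - c) <= N (a - b) + N (b - c).
Proof. by have := normD (a - b) (b - c); rewrite addrA subrK. Qed.

Lemma normBC a b : N (a - b) = N (b - a).
Proof. by rewrite -normN opprB. Qed.

Lemma cvg_normP {T : Type} (G : set_system T) {FG : Filter G} (f : T -> F) l :
  f @ G --> l <-> forall e : R, 0 < e -> \forall x \near G, N (f x - l) < e.
Proof.
split=> [fl e e0|h S].
  apply: (fl [set y | N (y - l) < e]); case: hN => _ _ _ nb; apply/nb.
  by exists e.
case: hN => _ _ _ nb /nb[e e0 eS].
apply: filterS (h e e0) => x; exact: eS.
Qed.

Lemma norm_cvg_unique {T : Type} (G : set_system T) {FG : ProperFilter G}
  (f : T -> F) (l l' : F) : f @ G --> l -> f @ G --> l' -> l = l'.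
Proof.
move=> /cvg_normP fl /cvg_normP fl'; apply/eqP; rewrite -subr_eq0; apply/eqP.
apply: norm_le_eq0 => e e0.
have e20 : 0 < e / 2 by lra.
have [x []] := filter_ex (filterI (fl _ e20) (fl' _ e20)).
rewrite normBC => h1 h2.
by have := normB_le l (f x) l'; lra.
Qed.

(* The set of s such that N (phi r - phi 0) <= k' r on [0, s] is closed and
   open in [0, 1]; argue at its supremum. *)
Lemma mean_value_inequality (phi : R -> F) (k : R) :
  (forall s : R, 0 <= s <= 1 -> forall k' : R, k < k' -> exists2 d : R, 0 < d &
     forall r : R, `|r - s| < d -> N (phi r - phi s) <= k' * `|r - s|) ->
  N (phi 1 - phi 0) <= k.
Proof.
move=> H; apply/ler_addgt0Pr => e e0; set k' := k + e.
have kk' : k < k' by rewrite /k'; lra.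
pose S := [set s : R | 0 <= s <= 1 /\
  forall r, 0 <= r <= s -> N (phi r - phi 0) <= k' * r].
have S0 : S 0.
  split; first by rewrite lexx ler01.
  move=> r /andP[r0 r1].
  have -> : r = 0 by apply/eqP; rewrite eq_le r0 r1.
  by rewrite subrr norm0 mulr0 lexx.
have supS : has_sup S by split; [exists 0|exists 1 => s [/andP[_ s1] _]].
set c := sup S.
have c0 : 0 <= c by apply: sup_upper_bound.
have c1 : c <= 1 by apply: ge_sup; [exists 0|move=> s [/andP[_ s1] _]].
have [d d0 hd] := H c (introT andP (conj c0 c1)) _ kk'.
have below r : 0 <= r < c -> N (phi r - phi 0) <= k' * r.
  move=> /andP[r0 rc].
  have /(sup_adherent)/(_ supS)[s Ss] : 0 < c - r by lra.
  rewrite subKr => rs; case: Ss => _; apply; lra.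
have atc : N (phi c - phi 0) <= k' * c.
  have [->|cn0] := eqVneq c 0; first by rewrite subrr norm0 mulr0 lexx.
  have cp : 0 < c by rewrite lt_neqAle eq_sym cn0.
  (* Half the minimum keeps [r] nonnegative, strictly below [c] and within [d] of it. *)
  pose r := c - Num.min c d / 2.
  have m0 : 0 < Num.min c d by rewrite lt_min cp d0.
  have mc : Num.min c d <= c by rewrite ge_min lexx.
  have md : Num.min c d <= d by rewrite ge_min lexx orbT.
  have r0c : 0 <= r < c by rewrite /r; lra.
  have rd : `|r - c| = c - r by rewrite ler0_norm ?opprB //; lra.
  have := hd r; rewrite rd => /(_ ltac:(rewrite /r; lra)).
  have := below r r0c; have := normB_le (phi c) (phi r) (phi 0).
  rewrite [N (phi c - phi r)]normBC; lra.
have upto r : 0 <= r < c + d -> N (phi r - phi 0) <= k' * r.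
  move=> rr; have [rc|cr|->] := ltgtP r c; first by apply: below; lra.
    have rd : `|r - c| = r - c by rewrite ger0_norm //; lra.
    have := hd r; rewrite rd => /(_ ltac:(lra)).
    have := normB_le (phi r) (phi c) (phi 0); lra.
  exact: atc.
have [c1'|cn1] := ltP c 1; last first.
  by have := upto 1; rewrite mulr1; apply; lra.
(* A member of [S] beyond [c], which contradicts the supremum; the minimum with [1] keeps it in the
   interval. *)
have S' : S (Num.min 1 (c + d / 2)).
  split; first by rewrite ge_min lexx le_min ler01 andbT; lra.
  move=> r /andP[r0]; rewrite le_min => /andP[r1 rc]; apply: upto; lra.
have : Num.min 1 (c + d / 2) <= c by apply: sup_upper_bound.
rewrite ge_min => /orP[]; lra.
Qed.

End CompatibleNorm.

(** * Real directional derivatives and their uniformity *)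

Section RealDerivatives.
Context {R : realType} {E F : topologicalLmodType R[i]}.

Definition has_rderive (f : E -> F) (x v : E) (l : F) : Prop :=
  rquot f x v t @[t --> 0^'] --> l.

Definition C1_on (O : set E) (g : E -> F) : Prop :=
  forall x v, O x -> rderivable g x v /\
    {for (x, v), continuous (fun p : E * E => rderive g p.1 p.2)}.

Lemma near_dnbhs0P (P : R -> Prop) :
  (\forall t \near (0 : R)^', P t) <->
  exists2 d : R, 0 < d & forall t : R, t != 0 -> `|t| < d -> P t.
Proof.
split=> [/nbhs_ballP[d /= d0 h]|[d d0 h]].
  exists d => // t t0 td; apply: h => //=.
  by rewrite /ball/= sub0r normrN.
apply/nbhs_ballP; exists d => //= t; rewrite /ball/= sub0r normrN => td t0.
exact: h.
Qed.

Lemma near_nbhs0P (P : R -> Prop) :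
  (\forall t \near (0 : R), P t) <->
  exists2 d : R, 0 < d & forall t : R, `|t| < d -> P t.
Proof.
split=> [/nbhs_ballP[d /= d0 h]|[d d0 h]].
  exists d => // t td; apply: h => //=.
  by rewrite /ball/= sub0r normrN.
apply/nbhs_ballP; exists d => //= t; rewrite /ball/= sub0r normrN => td.
exact: h.
Qed.

Lemma real_complex_continuous : continuous (fun t : R => (t%:C : R[i]^o)).
Proof.
move=> t; apply/cvgrPdist_lt => e; rewrite ltcE => /andP[/eqP/= e0 er].
have /cvgrPdist_lt/(_ _ er) : (fun x : R => x) @ t --> t by exact: cvg_id.
apply: filterS => s /= h.
have : `|(t - s)%:C : R[i]| < e.
  by rewrite ltcE normc_def /= expr0n addr0 sqrtr_sqr e0 eqxx.
by rewrite rmorphB.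
Qed.

Context {N : F -> R}.
Hypothesis hN : compatible_norm N.

(** With the denominator cleared, the bound includes [t = 0] and is close in shape to the hypothesis
    of [mean_value_inequality]. *)
Lemma has_rderiveP f x v l : has_rderive f x v l <->
  forall e : R, 0 < e -> exists2 d : R, 0 < d & forall t : R, `|t| < d ->
    N (f (x + t%:C *: v) - f x - t%:C *: l) <= e * `|t|.
Proof.
have key (t : R) : t != 0 ->
    N (f (x + t%:C *: v) - f x - t%:C *: l) = N (rquot f x v t - l) * `|t|.
  move=> t0; rewrite mulrC -(normRZ hN) /rquot scalerBr scalerA -rmorphM.
  by rewrite divff // scale1r.
split=> [/(cvg_normP hN) h e e0|h].
  have /near_dnbhs0P[d d0 hd] := h e e0; exists d => // t td.
  have [->|t0] := eqVneq t 0.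
    by rewrite !scale0r addr0 subrr subrr (norm0 hN) normr0 mulr0.
  by rewrite key // ler_pM2r ?normr_gt0 // ltW // hd.
apply/(cvg_normP hN) => e e0; have e20 : 0 < e / 2 by rewrite divr_gt0.
have [d d0 hd] := h _ e20; apply/near_dnbhs0P; exists d => // t t0 td.
have := hd t td; rewrite key // ler_pM2r ?normr_gt0 //; lra.
Qed.

Lemma has_rderive_unique f x v l l' :
  has_rderive f x v l -> has_rderive f x v l' -> l = l'.
Proof. exact: (norm_cvg_unique hN). Qed.

Lemma has_rderiveE f x v l : has_rderive f x v l -> rderive f x v = l.
Proof.
move=> h; apply: (has_rderive_unique _ h).
by rewrite /rderive; case: xgetP => [y _ //|/(_ l)].
Qed.

Lemma rderivableP f x v : rderivable f x v -> has_rderive f x v (rderive f x v).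
Proof. by case=> l h; rewrite (has_rderiveE h). Qed.

Lemma has_rderiveD f g x v l m : has_rderive f x v l -> has_rderive g x v m ->
  has_rderive (fun y => f y + g y) x v (l + m).
Proof.
move=> /(cvg_normP hN) hf /(cvg_normP hN) hg; apply/(cvg_normP hN) => e e0.
have e20 : 0 < e / 2 by rewrite divr_gt0.
apply: filterS (filterI (hf _ e20) (hg _ e20)) => t [h1 h2].
have -> : rquot (fun y => f y + g y) x v t - (l + m)
        = (rquot f x v t - l) + (rquot g x v t - m).
  rewrite /rquot [RHS]addrACA -scalerDr -opprD; congr (_ *: _ - _).
  by rewrite opprD addrACA.
have := normD hN (rquot f x v t - l) (rquot g x v t - m); lra.
Qed.

Lemma has_rderive_near f g x v l :
  (\forall t \near (0 : R), f (x + t%:C *: v) = g (x + t%:C *: v)) ->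
  has_rderive f x v l -> has_rderive g x v l.
Proof.
move=> /near_nbhs0P[d d0 h] /has_rderiveP hf; apply/has_rderiveP => e e0.
have [d' d'0 h'] := hf e e0.
exists (Num.min d d'); first by rewrite lt_min d0.
move=> t; rewrite lt_min => /andP[td td']; rewrite -h //.
have := h 0; rewrite normr0 !scale0r addr0 => <- //.
exact: h'.
Qed.

Lemma has_rderive_scale f x v l (c : R) :
  has_rderive f x v l -> has_rderive f x (c%:C *: v) (c%:C *: l).
Proof.
move=> /has_rderiveP hf; apply/has_rderiveP => e e0.
have c10 : 0 < `|c| + 1 by rewrite ltr_wpDl.
have [d d0 h] := hf (e / (`|c| + 1)) (divr_gt0 e0 c10).
exists (d / (`|c| + 1)); first by rewrite divr_gt0.
move=> t; rewrite ltr_pdivlMr // => td.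
rewrite !scalerA -!rmorphM.
have tc : `|t * c| <= `|t| * (`|c| + 1) by rewrite normrM ler_pM //; lra.
apply: (le_trans (h _ _)); first by apply: le_lt_trans td.
have -> : e * `|t| = e / (`|c| + 1) * (`|t| * (`|c| + 1)).
  by field; rewrite gt_eqF.
by rewrite ler_pM2l // divr_gt0.
Qed.

Lemma rderive_scale (f : E -> F) x v (c : R) :
  rderivable f x v -> rderive f x (c%:C *: v) = c%:C *: rderive f x v.
Proof. by move=> /rderivableP h; rewrite (has_rderiveE (has_rderive_scale h)). Qed.

Lemma tvs_cvgD {V : topologicalLmodType R[i]} {T : Type} (G : set_system T)
  {FG : Filter G} (f g : T -> V) (a b : V) :
  f @ G --> a -> g @ G --> b -> (f x + g x) @[x --> G] --> a + b.
Proof.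
move=> hf hg.
exact (@continuous2_cvg T V V V G FG f g +%R a b (@add_continuous V (a, b)) hf hg).
Qed.

Lemma tvs_cvgZ {V : topologicalLmodType R[i]} {T : Type} (G : set_system T)
  {FG : Filter G} (c : T -> R[i]^o) (f : T -> V) (z : R[i]^o) (a : V) :
  c @ G --> z -> f @ G --> a -> ((c x : R[i]) *: f x) @[x --> G] --> (z : R[i]) *: a.
Proof.
move=> hc hf.
exact (@continuous2_cvg T R[i]^o V V G FG c f *:%R z a
  (@scale_continuous R[i] V (z, a)) hc hf).
Qed.

Lemma near_line (O : set E) (x v : E) : open O -> O x ->
  \forall t \near (0 : R), O (x + t%:C *: v).
Proof.
move=> oO Ox.
have : (x + (t%:C : R[i]^o) *: v) @[t --> (0 : R)] --> x + (0%:C : R[i]^o) *: v.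
  apply: tvs_cvgD; first exact: cvg_cst.
  apply: tvs_cvgZ; first exact: real_complex_continuous.
  exact: cvg_cst.
by rewrite scale0r addr0; apply; exact: open_nbhs_nbhs.
Qed.

(* Joint continuity of the derivative and the mean value inequality give
   differentiability uniform in base point and direction. *)
Lemma strict_derivative (O : set E) (g : E -> F) x v : open O -> C1_on O g -> O x ->
  forall e : R, 0 < e -> exists2 d : R, 0 < d & \forall p \near (x, v), forall t : R, `|t| < d ->
    N (g (p.1 + t%:C *: p.2) - g p.1 - t%:C *: rderive g x v) <= e * `|t|.
Proof.
move=> oO gC1 Ox e e0; set L := rderive g x v.
have e20 : 0 < e / 2 by rewrite divr_gt0.
have hc : \forall p \near (x, v), N (rderive g p.1 p.2 - L) < e / 2.
  by have [_ /(cvg_normP hN)] := gC1 x v Ox; apply.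
have hO : \forall p \near (x, v), O p.1.
  have : (fun p : E * E => p.1) @ (x, v) --> x by exact: cvg_fst.
  by apply; exact: open_nbhs_nbhs.
(* The point reached from a base point along a direction, paired with that direction. Continuity of
   [Phi] at [t = 0] keeps whole segments inside [O] and inside the region where the derivative is
   [e / 2]-close to [L]. *)
pose Phi (q : (E * E) * R) : E * E := (q.1.1 + (q.2%:C : R[i]^o) *: q.1.2, q.1.2).
have Phic : Phi q @[q --> ((x, v), 0 : R)] --> (x, v).
  have c11 : q.1.1 @[q --> ((x, v), 0 : R)] --> x.
    exact (@cvg_comp _ _ _ (@fst (E * E) R) fst _ _ _ cvg_fst cvg_fst).
  have c12 : q.1.2 @[q --> ((x, v), 0 : R)] --> v.
    exact (@cvg_comp _ _ _ (@fst (E * E) R) snd _ _ _ cvg_fst cvg_snd).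
  have cz : (q.2%:C : R[i]^o) @[q --> ((x, v), 0 : R)] --> (0%:C : R[i]^o).
    exact (@cvg_comp _ _ _ (@snd (E * E) R) (fun t : R => (t%:C : R[i]^o)) _ _ _
      cvg_snd (@real_complex_continuous 0)).
  have := @tvs_cvgD _ _ _ (nbhs_filter _) _ _ _ _ c11
    (@tvs_cvgZ _ _ _ (nbhs_filter _) _ _ _ _ cz c12); rewrite scale0r addr0 => c1.
  exact (cvg_pair c1 c12).
have [[U V] /= [nU /near_nbhs0P[d d0 hV]] UV] := Phic _ (filterI hc hO).
exists d => //; apply: filterS nU => -[y h] Uyh t td /=.
have [->|t0] := eqVneq t 0.
  by rewrite !scale0r addr0 subrr subr0 (norm0 hN) normr0 mulr0.
(* Removing the linear term leaves a function of [s] whose derivative has norm at most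
   [e / 2 * |t|]; the other half of [e] absorbs the error of the difference quotient. *)
pose phi s := g (y + (s * t)%:C *: h) - (s * t)%:C *: L.
have -> : g (y + t%:C *: h) - g y - t%:C *: L = phi 1 - phi 0.
  by rewrite /phi mul1r mul0r !scale0r addr0 subr0 addrAC.
apply: (mean_value_inequality hN) => s /andP[s0 s1] k' ek'.
have std : `|s * t| < d.
  by rewrite normrM ger0_norm //; apply: le_lt_trans td; rewrite ler_piMl.
have := UV ((y, h), s * t) (conj Uyh (hV _ std)).
rewrite /Phi /=; set q := y + _ => -[hq Oq].
have /has_rderiveP/(_ _ e20)[d1 d10 hd1] := rderivableP (gC1 q h Oq).1.
have t00 : 0 < `|t| by rewrite normr_gt0.
exists (d1 / `|t|); first by rewrite divr_gt0.
move=> r; rewrite ltr_pdivlMr // -normrM => rs.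
have -> : phi r - phi s = (g (q + ((r - s) * t)%:C *: h) - g q
    - ((r - s) * t)%:C *: rderive g q h) + ((r - s) * t)%:C *: (rderive g q h - L).
  have -> : q + ((r - s) * t)%:C *: h = y + (r * t)%:C *: h.
    by rewrite /q -addrA -scalerDl -rmorphD -mulrDl subrKC.
  rewrite scalerBr addrA subrK /phi -/q mulrBl rmorphB scalerBl.
  by rewrite !opprD !opprK addrACA.
apply: (le_trans (normD hN _ _)); rewrite (normRZ hN).
apply: (@le_trans _ _ (e * `|(r - s) * t|)); last first.
  by rewrite normrM mulrCA mulrC ler_wpM2r // mulrC ltW // mulrC.
have -> : e * `|(r - s) * t| = e / 2 * `|(r - s) * t| + `|(r - s) * t| * (e / 2) by field.
by apply: lerD; [exact: hd1|rewrite ler_wpM2l // ltW].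
Qed.

End RealDerivatives.

(** * Linear identities in modules by reflection *)

Inductive module_expr (K : Type) :=
  | MVar of nat
  | MZero
  | MAdd of module_expr K & module_expr K
  | MOpp of module_expr K
  | MScale of K & module_expr K.

Section ModuleReflection.
Context {K : nzRingType} {V : lmodType K}.

Fixpoint module_eval (env : seq V) (e : module_expr K) : V :=
  match e with
  | MVar j => env`_j
  | MZero => 0
  | MAdd e1 e2 => module_eval env e1 + module_eval env e2
  | MOpp e1 => - module_eval env e1
  | MScale c e1 => c *: module_eval env e1
  end.

(** The test is [Nat.eqb] so that [cbn] can evaluate it on concrete indices and leave pure ring
    identities. *)
Fixpoint module_coef (e : module_expr K) (i : nat) : K :=
  match e with
  | MVar j => if Nat.eqb j i then 1 else 0
  | MZero => 0
  | MAdd e1 e2 => module_coef e1 i + module_coef e2 i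
  | MOpp e1 => - module_coef e1 i
  | MScale c e1 => c * module_coef e1 i
  end.

Lemma module_evalE env e :
  module_eval env e = \sum_(i < size env) module_coef e i *: env`_i.
Proof.
elim: e => [j||e1 IH1 e2 IH2|e1 IH|c e1 IH] /=.
- case: (ltnP j (size env)) => js.
    rewrite (bigD1 (Ordinal js)) //= PeanoNat.Nat.eqb_refl scale1r big1 ?addr0 //.
    move=> i /eqP ij; case: PeanoNat.Nat.eqb_spec => [ji|_]; last exact: scale0r.
    by case: ij; apply: val_inj.
  (* An index beyond the environment evaluates to the default [0], and its coefficient vanishes at
     every index in range. *)
  rewrite nth_default // big1 // => i _.
  case: PeanoNat.Nat.eqb_spec => [ji|_]; last exact: scale0r.
  by move: (ltn_ord i); rewrite -ji ltnNge js.
- by rewrite big1 // => i _; rewrite scale0r.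
- by rewrite IH1 IH2 -big_split; apply: eq_bigr => i _; rewrite scalerDl.
- by rewrite IH -sumrN; apply: eq_bigr => i _; rewrite scaleNr.
- by rewrite IH scaler_sumr; apply: eq_bigr => i _; rewrite scalerA.
Qed.

Fixpoint same_coefs (n : nat) (e1 e2 : module_expr K) : Prop :=
  if n is n'.+1 then module_coef e1 n' = module_coef e2 n' /\ same_coefs n' e1 e2
  else True.

Lemma module_reflection env e1 e2 : same_coefs (size env) e1 e2 ->
  module_eval env e1 = module_eval env e2.
Proof.
rewrite !module_evalE => h; apply: eq_bigr => i _; congr (_ *: _).
elim: (size env) (i : nat) (ltn_ord i) h => //= n IH j.
by rewrite ltnS leq_eqVlt => /orP[/eqP ->|jn] [hn h] //; exact: IH.
Qed.

End ModuleReflection.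

(* Atoms are compared by [cmp]: syntactically at first, then up to conversion, as
   the same term may carry different paths through the hierarchy of structures. *)
Ltac module_index cmp x l :=
  lazymatch l with
  | ?y :: ?l' =>
      match l with
      | _ => let _ := match goal with _ => cmp x y end in constr:(0%N)
      | _ => let n := module_index cmp x l' in constr:(n.+1)
      end
  end.

Ltac module_atoms cmp t l :=
  lazymatch t with
  | GRing.add ?a ?b => let l := module_atoms cmp a l in module_atoms cmp b l
  | GRing.opp ?a => module_atoms cmp a l
  | GRing.scale _ ?a => module_atoms cmp a l
  | GRing.zero => l
  | _ => match l with
         | _ => let _ := module_index cmp t l in l
         | _ => constr:(t :: l)
         end
  end.

Ltac module_reify cmp K t l :=
  lazymatch t with
  | GRing.add ?a ?b =>
      let a := module_reify cmp K a l in
      let b := module_reify cmp K b l in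
      constr:(MAdd a b)
  | GRing.opp ?a => let a := module_reify cmp K a l in constr:(MOpp a)
  | GRing.scale ?c ?a =>
      let a := module_reify cmp K a l in constr:(@MScale K c a)
  | GRing.zero => constr:(MZero K)
  | _ => let n := module_index cmp t l in constr:(MVar K n)
  end.

Ltac module_with cmp K :=
  lazymatch goal with
  | |- @eq ?T ?a ?b =>
      let l := module_atoms cmp a (@nil T) in
      let l := module_atoms cmp b l in
      let e1 := module_reify cmp K a l in
      let e2 := module_reify cmp K b l in
      refine (@module_reflection _ _ l e1 e2 _);
      cbn [same_coefs size module_coef Nat.eqb]; repeat split; ring
  end.

Ltac module_cmp_syntactic x y := constr_eq x y.
Ltac module_cmp_convertible x y := unify x y.

(* Linear identities in a module, up to ring identities between scalars. *)
Ltac module K :=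
  first [module_with module_cmp_syntactic K | module_with module_cmp_convertible K].

(** * Additivity in the direction and second differences *)

Section SecondDerivatives.
Context {R : realType} {E F : topologicalLmodType R[i]}.

Lemma plane_cvg (x v w : E) :
  (x + q.1%:C *: v + q.2%:C *: w) @[q --> ((0, 0) : R * R)] --> x.
Proof.
have c1 : (q.1%:C : R[i]^o) @[q --> ((0, 0) : R * R)] --> (0%:C : R[i]^o).
  exact (@cvg_comp _ _ _ (@fst R R) (fun t : R => (t%:C : R[i]^o)) _ _ _
    cvg_fst (@real_complex_continuous R 0)).
have c2 : (q.2%:C : R[i]^o) @[q --> ((0, 0) : R * R)] --> (0%:C : R[i]^o).
  exact (@cvg_comp _ _ _ (@snd R R) (fun t : R => (t%:C : R[i]^o)) _ _ _
    cvg_snd (@real_complex_continuous R 0)).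
have nf := nbhs_filter ((0, 0) : R * R).
have cx : (fun q : R * R => x) @ ((0, 0) : R * R) --> x by exact: cvg_cst.
have cv : (fun q : R * R => v) @ ((0, 0) : R * R) --> v by exact: cvg_cst.
have cw : (fun q : R * R => w) @ ((0, 0) : R * R) --> w by exact: cvg_cst.
have := @tvs_cvgD R _ _ _ nf _ _ _ _ (@tvs_cvgD R _ _ _ nf _ _ _ _ cx
   (@tvs_cvgZ R _ _ _ nf _ _ _ _ c1 cv)) (@tvs_cvgZ R _ _ _ nf _ _ _ _ c2 cw).
by rewrite !scale0r !addr0.
Qed.

Lemma near_plane (x v w : E) (P : E -> Prop) : nbhs x P ->
  exists2 d : R, 0 < d & forall s t : R, `|s| < d -> `|t| < d ->
    P (x + s%:C *: v + t%:C *: w).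
Proof.
move=> nP; have [[U V] /= [/near_nbhs0P[d d0 hU] /near_nbhs0P[d' d'0 hV]] UV] := plane_cvg v w nP.
exists (Num.min d d'); first by rewrite lt_min d0.
move=> s t; rewrite !lt_min => /andP[sd _] /andP[_ td].
exact: (UV (s, t) (conj (hU s sd) (hV t td))).
Qed.

Lemma line_cvg (x v : E) : (x + t%:C *: v) @[t --> (0 : R)] --> x.
Proof.
move=> P nP; have [d d0 h] := near_plane v 0 nP; apply/near_nbhs0P; exists d => // t td.
by have := h t 0 td; rewrite normr0 => /(_ d0); rewrite scaler0 addr0.
Qed.

Context {N : F -> R}.
Hypothesis hN : compatible_norm N.
Variables (O : set E) (oO : open O).

Lemma near_line_pair (x v w : E) (P : E * E -> Prop) : nbhs (x, w) P ->
  exists2 d : R, 0 < d & forall t : R, `|t| < d -> P (x + t%:C *: v, w).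
Proof.
move=> [[U V] /= [Ux Vw] UV].
have /near_nbhs0P[d d0 hU] := line_cvg v Ux.
exists d => // t td; apply: UV; split=> /=; first exact: hU.
exact: nbhs_singleton.
Qed.

(** The increment along [v + w] is split into a step along [v] and a step along [w]. The second step
    starts at the moving point [x + t v], which is why the uniform estimate of [strict_derivative]
    is needed for [w]. *)
Lemma rderiveD (g : E -> F) x v w : C1_on O g -> O x ->
  rderive g x (v + w) = rderive g x v + rderive g x w.
Proof.
move=> gC1 Ox; apply: (has_rderiveE hN); apply/(has_rderiveP hN) => e e0.
have e20 : 0 < e / 2 by rewrite divr_gt0.
have [d d0 ns] := strict_derivative hN w oO gC1 Ox e20.
have [d1 d10 hw] := near_line_pair v ns.
have /(has_rderiveP hN)/(_ _ e20)[d2 d20 hv] := rderivableP hN (gC1 x v Ox).1.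
exists (Num.min d (Num.min d1 d2)); first by rewrite !lt_min d0 d10.
move=> t; rewrite !lt_min => /and3P[td td1 td2].
have := hw t td1 t td; have := hv t td2 => /=.
set a := _ - _ - _; set b := _ - _ - _ => ha hb.
have -> : g (x + t%:C *: (v + w)) - g x - t%:C *: (rderive g x v + rderive g x w)
  = b + a.
  have -> : x + t%:C *: (v + w) = x + t%:C *: v + t%:C *: w.
    by rewrite scalerDr addrA.
  by rewrite /a /b; module R[i].
by have := normD hN b a; lra.
Qed.

Lemma rderive_opp (g : E -> F) x v : C1_on O g -> O x ->
  rderive g x (- v) = - rderive g x v.
Proof.
move=> gC1 Ox; rewrite -scaleN1r -[- rderive _ _ _]scaleN1r.
have -> : -1 = (-1)%:C :> R[i] by rewrite rmorphN rmorph1.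
by rewrite (rderive_scale hN) //; exact: (gC1 x v Ox).1.
Qed.

Lemma C2_C1 (f : E -> F) : C2_on O f -> C1_on O f.
Proof. by case=> _ h _ x v Ox; exact: h. Qed.

Lemma C2_C1_rderive (f : E -> F) v : C2_on O f -> C1_on O (fun y => rderive f y v).
Proof.
case=> _ _ h x w Ox; split; first by have [] := h x v w Ox.
have [_ c] := h x v w Ox.
have pc : (fun p : E * E => (p.1, v, p.2)) @ (x, w) --> (x, v, w).
  have cv : (fun p : E * E => v) @ (x, w) --> v by exact: cvg_cst.
  have c12 : (fun p : E * E => (p.1, v)) @ (x, w) --> (x, v).
    exact (cvg_pair cvg_fst cv).
  exact (cvg_pair c12 cvg_snd).
exact (@cvg_comp _ _ _ (fun p : E * E => (p.1, v, p.2))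
  (fun p : E * E * E => rderive2 f p.1.1 p.1.2 p.2) _ _ _ pc c).
Qed.

(** Mean value inequality for [psi], the difference of [f] along two parallel segments in direction
    [v], a distance [t w] apart. Its derivative compares [rderive f _ v] at two points that differ
    by [t w], and strict differentiability of this function along [w] evaluates it up to
    [e * |t|]. *)
Lemma second_difference (f : E -> F) x v w : C2_on O f -> O x ->
  forall e : R, 0 < e -> exists2 d : R, 0 < d & forall t : R, `|t| < d ->
    N (f (x + t%:C *: v + t%:C *: w) - f (x + t%:C *: v) - (f (x + t%:C *: w) - f x)
       - (t * t)%:C *: rderive2 f x v w) <= e * (t * t).
Proof.
move=> fC2 Ox e e0; set L := rderive2 f x v w.
have fC1 := C2_C1 fC2; have gC1 := C2_C1_rderive v fC2.
have [d d0 ns] := strict_derivative hN w oO gC1 Ox e0.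
have [d1 d10 hw] := near_line_pair v ns.
have nO : nbhs x O by exact: open_nbhs_nbhs.
have [d2 d20 hO] := near_plane v w nO.
exists (Num.min d (Num.min d1 d2)); first by rewrite !lt_min d0 d10.
move=> t; rewrite !lt_min => /and3P[td td1 td2].
have [->|t0] := eqVneq t 0.
  by rewrite !mulr0 !scale0r !addr0 !subrr (norm0 hN) lexx.
have t00 : 0 < `|t| by rewrite normr_gt0.
pose psi s := f (x + (s * t)%:C *: v + t%:C *: w) - f (x + (s * t)%:C *: v)
  - (s * (t * t))%:C *: L.
have -> : f (x + t%:C *: v + t%:C *: w) - f (x + t%:C *: v) -
    (f (x + t%:C *: w) - f x) - (t * t)%:C *: L = psi 1 - psi 0.
  by rewrite /psi !mul1r !mul0r !scale0r !addr0 subr0 addrAC.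
apply: (mean_value_inequality hN) => s /andP[s0 s1] k' ek'.
have stt : `|s * t| <= `|t| by rewrite normrM ger0_norm // ler_piMl.
have := hw (s * t) (le_lt_trans stt td1) t td => /=.
have Oq := hO (s * t) t (le_lt_trans stt td2) td2.
have := hO (s * t) 0 (le_lt_trans stt td2); rewrite normr0 => /(_ d20).
rewrite scale0r addr0; set y := x + (s * t)%:C *: v => Oy.
rewrite -/y in Oq; set q := y + t%:C *: w in Oq * => hqy.
(* Two first-order errors, one on each segment, share the slack between [k'] and [e * (t * t)]; the
   factor [|t|] converts [m] back to [r - s]. *)
pose k1 := (k' - e * (t * t)) / (2 * `|t|).
have k10 : 0 < k1 by rewrite divr_gt0 ?subr_gt0 // mulr_gt0.
have /(has_rderiveP hN)/(_ _ k10)[e1 e10 h1] := rderivableP hN (fC1 q v Oq).1.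
have /(has_rderiveP hN)/(_ _ k10)[e2 e20 h2] := rderivableP hN (fC1 y v Oy).1.
exists (Num.min e1 e2 / `|t|); first by rewrite divr_gt0 // lt_min e10.
move=> r; rewrite ltr_pdivlMr // -normrM lt_min => /andP[rs1 rs2].
set m := (r - s) * t in rs1 rs2 *.
have := h1 m rs1; have := h2 m rs2.
have -> : y + m%:C *: v = x + (r * t)%:C *: v.
  by rewrite /y /m; module R[i].
have -> : q + m%:C *: v = x + (r * t)%:C *: v + t%:C *: w.
  by rewrite /q /y /m; module R[i].
set fy := f (x + _); set fq := f (x + _ + _).
set a := fy - f y - _; set b := fq - f q - _ => ha hb.
set c := rderive f q v - rderive f y v - t%:C *: L in hqy *.
have -> : psi r - psi s = b - a + m%:C *: c.
  rewrite /psi -/q -/y -/fy -/fq /c /a /b /m.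
  by module R[i].
have Dle : N (b - a) <= 2 * k1 * `|m|.
  have := normD hN b (- a); rewrite (normN hN); lra.
have tt : `|t| * `|t| = t * t by rewrite -normrM ger0_norm // -expr2 sqr_ge0.
have -> : k' * `|r - s| = 2 * k1 * `|m| + e * `|t| * `|m|.
  rewrite /k1 /m normrM -tt; field; exact: lt0r_neq0.
apply: (le_trans (normD hN _ _)); apply: lerD => //.
by rewrite (normRZ hN) mulrC ler_wpM2r.
Qed.

End SecondDerivatives.

(** * Pluriharmonic functions *)

Lemma mulCii {R : realType} : 'i%C * 'i%C = -1 :> R[i].
Proof. by rewrite -expr2 sqr_i. Qed.

Section Pluriharmonic.
Context {R : realType} {E F : topologicalLmodType R[i]} {N : F -> R}.
Hypothesis hN : compatible_norm N.
Variables (O : set E) (oO : open O).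

(** Schwarz's theorem: the second difference does not change when [v] and [w] are exchanged, so both
    mixed derivatives approximate the same quantity divided by [t * t]. *)
Lemma rderive2_sym (f : E -> F) x v w : C2_on O f -> O x ->
  rderive2 f x v w = rderive2 f x w v.
Proof.
move=> fC2 Ox; apply/eqP; rewrite -subr_eq0; apply/eqP.
apply: (norm_le_eq0 hN) => e e0; have e20 : 0 < e / 2 by rewrite divr_gt0.
have [d d0 hd] := second_difference hN oO v w fC2 Ox e20.
have [d' d'0 hd'] := second_difference hN oO w v fC2 Ox e20.
pose t : R := Num.min d d' / 2.
have m0 : 0 < Num.min d d' by rewrite lt_min d0.
have t0 : 0 < t by rewrite divr_gt0.
have tm : `|t| < Num.min d d' by rewrite gtr0_norm // /t; lra.
move: tm; rewrite lt_min => /andP[td td'].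
have := hd t td; have := hd' t td'.
set a := _ - _ - _ - _; set b := _ - _ - _ - _ => ha hb.
have tt0 : 0 < t * t by rewrite mulr_gt0.
rewrite -(ler_pM2l tt0) -{1}(ger0_norm (ltW tt0)) -(normRZ hN).
have -> : (t * t)%:C *: (rderive2 f x v w - rderive2 f x w v) = a - b.
  rewrite /a /b (addrAC x (t%:C *: w)).
  set A := f (x + _ + _); set B := f (x + t%:C *: v); set C := f (x + t%:C *: w).
  move: A B C (f x) (rderive2 f x v w) (rderive2 f x w v) => A B C D V W.
  module R[i].
apply: (le_trans (normD hN _ _)); rewrite (normN hN) [leRHS]mulrC.
rewrite [in leRHS](splitr e) mulrDl; exact: (lerD ha hb).
Qed.

Lemma has_rderive_line (f : E -> F) Z H (z w : R[i]^o) l :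
  has_rderive f (Z + (z : R[i]) *: H) ((w : R[i]) *: H) l ->
  has_rderive (fun z : R[i]^o => f (Z + (z : R[i]) *: H)) z w l.
Proof.
rewrite /has_rderive.
have -> // : rquot f (Z + (z : R[i]) *: H) ((w : R[i]) *: H) =
  rquot (fun z : R[i]^o => f (Z + (z : R[i]) *: H)) z w.
apply/funext => t; rewrite /rquot; congr (_ *: (f _ - _)).
by rewrite scalerA -addrA -scalerDl.
Qed.

Lemma has_rderiveZ (f : E -> F) x v l (c : R[i]) :
  has_rderive f x v l -> has_rderive (fun y => c *: f y) x v (c *: l).
Proof.
move=> h; have -> : (fun y => c *: f y) = *:%R c \o f by [].
rewrite /has_rderive.
have -> : rquot ( *:%R c \o f) x v = fun t => c *: rquot f x v t.
  by apply/funext => t; rewrite /rquot /= -scalerBr !scalerA mulrC.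
exact (@tvs_cvgZ R F _ _ _ (fun=> c : R[i]^o) _ _ _ (cvg_cst _) h).
Qed.

(* The holomorphic derivative, normalized as twice the Wirtinger derivative. *)
Definition del (f : E -> F) (y h : E) : F :=
  rderive f y h - 'i%C *: rderive f y ('i%C *: h).

Lemma has_rderive_del (f : E -> F) x v w : C2_on O f -> O x ->
  has_rderive (fun y => del f y v) x w
    (rderive2 f x v w - 'i%C *: rderive2 f x ('i%C *: v) w).
Proof.
move=> fC2 Ox.
have h v' : has_rderive (fun y => rderive f y v') x w (rderive2 f x v' w).
  exact: (rderivableP hN (C2_C1_rderive v' fC2 w Ox).1).
have := has_rderiveD hN (h v) (has_rderiveZ (c := - 'i%C) (h ('i%C *: v))).
rewrite scaleNr.
by congr (has_rderive _ _ _ _); apply/funext => y; rewrite /del scaleNr.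
Qed.

Lemma laplacianE (f : E -> F) Z H : C2_on O f -> O Z ->
  laplacian f Z H = 4^-1 *: (rderive2 f Z H H - 'i%C *: rderive2 f Z ('i%C *: H) H
    + 'i%C *: (rderive2 f Z H ('i%C *: H) -
                'i%C *: rderive2 f Z ('i%C *: H) ('i%C *: H))).
Proof.
move=> fC2 OZ; rewrite /laplacian.
set g := fun z : R[i]^o => _.
have nO : nbhs Z O by exact: open_nbhs_nbhs.
have dzg (z : R[i]^o) : O (Z + (z : R[i]) *: H) ->
    dz g z = 2^-1 *: del f (Z + (z : R[i]) *: H) H.
  move=> Oz; rewrite /dz /del; congr (_ *: (_ - _ *: _)).
    apply: (has_rderiveE hN); apply: has_rderive_line; rewrite scale1r.
    exact: (rderivableP hN (C2_C1 fC2 _ Oz).1).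
  apply: (has_rderiveE hN); apply: has_rderive_line.
  exact: (rderivableP hN (C2_C1 fC2 _ Oz).1).
have [iH eiH] : exists iH, iH = 'i%C *: H by exists ('i%C *: H).
rewrite -eiH.
have key (w : R[i]^o) k : k = (w : R[i]) *: H -> has_rderive (dz g) 0 w
    (2^-1 *: (rderive2 f Z H k - 'i%C *: rderive2 f Z iH k)).
  move=> ->; have := has_rderive_del (v := H) (w := (w : R[i]) *: H) fC2 OZ.
  rewrite -eiH => /(has_rderiveZ (c := 2^-1)).
  rewrite -{1}[Z]addr0 -{1}(scale0r H).
  (* [dz g] is identified with [del] only where the line stays in [O], which suffices for a
     derivative at [0]. *)
  move=> /(@has_rderive_line _ _ _ (0 : R[i]^o) w); apply: (has_rderive_near hN).
  have [d d0 hO] := near_plane ((w : R[i]) *: H) 0 nO.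
  apply/near_nbhs0P; exists d => // t td; rewrite dzg // add0r.
  have := hO t 0 td; rewrite normr0 => /(_ d0); rewrite scaler0 addr0 scalerA.
  exact.
have key1 : H = (1 : R[i]) *: H by rewrite scale1r.
rewrite /dzbar (has_rderiveE hN (key 1 H key1)) (has_rderiveE hN (key 'i%C iH eiH)).
have -> : 4^-1 = 2^-1 * 2^-1 :> R[i] by field.
module R[i].
Qed.

Variable f : E -> F.
Hypothesis ph : pluriharmonic_on O f.

Lemma rderive2Dr x u v w : O x ->
  rderive2 f x u (v + w) = rderive2 f x u v + rderive2 f x u w.
Proof. exact: (rderiveD hN oO v w (C2_C1_rderive u ph.1)). Qed.

Lemma rderive2Dl x u v w : O x ->
  rderive2 f x (u + v) w = rderive2 f x u w + rderive2 f x v w.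
Proof.
by move=> Ox; rewrite !(rderive2_sym _ w ph.1 Ox) rderive2Dr.
Qed.

(** Polarization. The symmetric biadditive form [B] vanishes on the diagonal, because [B h h] is
    four times the Laplacian along [h] once the cross terms cancel by symmetry; hence [B] vanishes
    everywhere. *)
Lemma pluriharmonic_rderive2 x v w : O x ->
  rderive2 f x ('i%C *: v) ('i%C *: w) = - rderive2 f x v w.
Proof.
move=> Ox; pose B v w := rderive2 f x v w + rderive2 f x ('i%C *: v) ('i%C *: w).
have B0 h : B h h = 0.
  rewrite /B; have := ph.2 x h Ox; rewrite (laplacianE _ ph.1 Ox).
  rewrite (rderive2_sym h ('i%C *: h) ph.1 Ox) => /eqP; rewrite scaler_eq0 => /orP[|/eqP].
    by rewrite invr_eq0 pnatr_eq0.
  move=> <-; move: (rderive2 f x ('i%C *: h) _) => C.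
  (* The square of ['i] is inserted by hand, since [module] treats ['i] as a free scalar. *)
  have {1}-> : C = - ('i%C * 'i%C) *: C by rewrite mulCii opprK scale1r.
  module R[i].
have : B (v + w) (v + w) = 0 by [].
have BC : B w v = B v w.
  by rewrite /B (rderive2_sym w _ ph.1 Ox) (rderive2_sym ('i%C *: w) _ ph.1 Ox).
have -> : B (v + w) (v + w) = B v v + B w w + (B v w + B w v).
  rewrite /B scalerDr; move: ('i%C *: v) ('i%C *: w) => iv iw.
  rewrite (rderive2Dl v w (v + w) Ox) (rderive2Dl iv iw (iv + iw) Ox).
  rewrite (rderive2Dr v v w Ox) (rderive2Dr w v w Ox).
  rewrite (rderive2Dr iv iv iw Ox) (rderive2Dr iw iv iw Ox); module R[i].
rewrite !B0 !add0r BC => /eqP; rewrite -mulr2n -scaler_nat scaler_eq0.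
by rewrite pnatr_eq0 /= /B addrC addr_eq0 => /eqP.
Qed.

(** The derivative of [del f _ v] at [x] along [w], by [has_rderive_del]. *)
Definition del2 x v w := rderive2 f x v w - 'i%C *: rderive2 f x ('i%C *: v) w.

Lemma rderive2_i x v w : O x -> rderive2 f x ('i%C *: v) w = rderive2 f x v ('i%C *: w).
Proof.
move=> Ox; have := pluriharmonic_rderive2 v ('i%C *: w) Ox.
rewrite scalerA mulCii scaleN1r.
have -> : rderive2 f x ('i%C *: v) (- w) = - rderive2 f x ('i%C *: v) w.
  by rewrite /rderive2 (rderive_opp hN w (C2_C1_rderive _ ph.1) Ox).
exact: oppr_inj.
Qed.

Lemma del2_sym x v w : O x -> del2 x v w = del2 x w v.
Proof.
move=> Ox; rewrite /del2 (rderive2_sym v _ ph.1 Ox) (rderive2_i v w Ox).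
by rewrite (rderive2_sym v _ ph.1 Ox).
Qed.

(** The Cauchy-Riemann equation for [del f _ v]: pluriharmonicity of [f] is what makes its
    holomorphic derivative holomorphic. *)
Lemma del2_ir x v w : O x -> del2 x v ('i%C *: w) = 'i%C *: del2 x v w.
Proof.
move=> Ox; rewrite /del2 pluriharmonic_rderive2 // -rderive2_i // scalerBr scalerA.
by rewrite mulCii scaleN1r scalerN !opprK addrC.
Qed.

Lemma del2Dr x u v w : O x -> del2 x u (v + w) = del2 x u v + del2 x u w.
Proof. by move=> Ox; rewrite /del2 !rderive2Dr //; module R[i]. Qed.

Lemma del2Rr x u v (c : R) : O x -> del2 x u (c%:C *: v) = c%:C *: del2 x u v.
Proof.
move=> Ox; rewrite /del2 /rderive2 !(rderive_scale hN) //; first by module R[i].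
  exact: (C2_C1_rderive _ ph.1 _ Ox).1.
exact: (C2_C1_rderive _ ph.1 _ Ox).1.
Qed.

Lemma del2Zr x u v (c : R[i]) : O x -> del2 x u (c *: v) = c *: del2 x u v.
Proof.
move=> Ox; rewrite [c]complexE !scalerDl -!scalerA.
set a := complex.Re c; set b := complex.Im c.
rewrite (del2Dr u (a%:C *: v) ('i%C *: (b%:C *: v)) Ox) (del2_ir u (b%:C *: v) Ox).
by rewrite (del2Rr u v a Ox) (del2Rr u v b Ox).
Qed.

Lemma del2Zl x u v (c : R[i]) : O x -> del2 x (c *: u) v = c *: del2 x u v.
Proof. by move=> Ox; rewrite (del2_sym (c *: u) v Ox) (del2Zr v u c Ox) (del2_sym v u Ox). Qed.

Lemma del2Dl x u v w : O x -> del2 x (u + v) w = del2 x u w + del2 x v w.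
Proof.
move=> Ox; rewrite (del2_sym (u + v) w Ox) (del2Dr w u v Ox).
by rewrite (del2_sym w u Ox) (del2_sym w v Ox).
Qed.

Lemma delD x v w : O x -> del f x (v + w) = del f x v + del f x w.
Proof.
move=> Ox; rewrite /del scalerDr (rderiveD hN oO v w (C2_C1 ph.1) Ox).
by rewrite (rderiveD hN oO ('i%C *: v) ('i%C *: w) (C2_C1 ph.1) Ox); module R[i].
Qed.

Lemma delZ x (c : R[i]) v : O x -> del f x (c *: v) = c *: del f x v.
Proof.
move=> Ox; have fC1 := C2_C1 ph.1.
have hR (t : R) y : del f x (t%:C *: y) = t%:C *: del f x y.
  have -> : del f x (t%:C *: y) =
     rderive f x (t%:C *: y) - 'i%C *: rderive f x (t%:C *: ('i%C *: y)).
    by rewrite /del !scalerA [_ * t%:C]mulrC.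
  rewrite (rderive_scale hN t (fC1 x y Ox).1).
  rewrite (rderive_scale hN t (fC1 x ('i%C *: y) Ox).1) /del.
  by module R[i].
have hi y : del f x ('i%C *: y) = 'i%C *: del f x y.
  rewrite /del !scalerA mulCii scaleN1r (rderive_opp hN _ fC1 Ox).
  by rewrite scalerBr scalerA mulCii scaleN1r scalerN !opprK addrC.
rewrite [c]complexE !scalerDl -!scalerA; set a := complex.Re c; set b := complex.Im c.
by rewrite (delD (a%:C *: v) ('i%C *: (b%:C *: v)) Ox) hi (hR a v) (hR b v).
Qed.

End Pluriharmonic.

(** * Complex difference quotients and moving directions *)

Section ComplexDerivatives.
Context {R : realType} {E F : topologicalLmodType R[i]} {N : F -> R}.
Hypothesis hN : compatible_norm N.
Variables (O : set E) (oO : open O).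

Lemma near_complex_dnbhs0 (P : R[i] -> Prop) (d : R) : 0 < d ->
  (forall z : R[i], z != 0 -> complex.Re `|z| < d -> P z) ->
  \forall z \near (0 : R[i]^o)^', P z.
Proof.
move=> d0 h; apply/nbhs_ballP; exists d%:C; first by rewrite /= ltcR.
move=> z; rewrite -ball_normE /ball_ /= sub0r normrN => zd z0; apply: h => //.
by move: zd; rewrite ltcE => /andP[_].
Qed.

Lemma Re_norm_gt0 (z : R[i]) : z != 0 -> 0 < complex.Re `|z|.
Proof. by rewrite -normr_gt0 ltcE => /andP[_]. Qed.

Lemma Re_norm_ge (z : R[i]) :
  `|complex.Re z| <= complex.Re `|z| /\ `|complex.Im z| <= complex.Re `|z|.
Proof.
rewrite normc_def /=; split; rewrite -sqrtr_sqr ler_wsqrtr //.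
  by rewrite lerDl sqr_ge0.
by rewrite lerDr sqr_ge0.
Qed.

Lemma complex_near_line (x v : E) (P : E -> Prop) : nbhs x P ->
  exists2 d : R, 0 < d & forall z : R[i], complex.Re `|z| < d -> P (x + z *: v).
Proof.
move=> nP; have [d d0 h] := near_plane v ('i%C *: v) nP; exists d => // z zd.
have [ra rb] := Re_norm_ge z.
have := h _ _ (le_lt_trans ra zd) (le_lt_trans rb zd).
by rewrite -addrA scalerA -scalerDl [_ * 'i%C]mulrC -complexE.
Qed.

Lemma norm_cquot (g : E -> F) x v (z : R[i]) l : z != 0 ->
  N (g (x + z *: v) - g x - z *: l) = complex.Re `|z| * N (cquot g x v z - l).
Proof.
by move=> z0; rewrite -(normZ hN) /cquot scalerBr scalerA divff // scale1r.
Qed.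

(** For [z = a + ib] the increment goes along [a v] and then, from the moving base point, along [b]
    times ['i v]. The Cauchy-Riemann equation merges the two linear terms into [z] times [L]. *)
Lemma cquot_CauchyRiemann (g : E -> F) x v : C1_on O g -> O x ->
  rderive g x ('i%C *: v) = 'i%C *: rderive g x v ->
  cquot g x v z @[z --> 0^'] --> rderive g x v.
Proof.
move=> gC1 Ox CR; set L := rderive g x v in CR *.
(* A quarter, because the two errors add up to [e / 4 * (|a| + |b|)], where [|a| + |b|] is at most
   twice the modulus of [z], and the final bound must be strict. *)
apply/(cvg_normP hN) => e e0; have e40 : 0 < e / 4 by rewrite divr_gt0.
have [d d0 /nbhs_singleton /= hv] := strict_derivative hN v oO gC1 Ox e40.
have [d' d'0 ni] := strict_derivative hN ('i%C *: v) oO gC1 Ox e40.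
have [d1 d10 hi] := near_line_pair v ni.
rewrite CR in hi.
have m0 : 0 < Num.min d (Num.min d' d1) by rewrite !lt_min d0 d'0.
apply: (near_complex_dnbhs0 m0) => z z0; rewrite !lt_min => /and3P[zd zd' zd1].
have [ra rb] := Re_norm_ge z; set a := complex.Re z in ra; set b := complex.Im z in rb.
have z00 := Re_norm_gt0 z0.
rewrite -(ltr_pM2l z00) -norm_cquot //.
have h1 := hv a (le_lt_trans ra zd).
have h2 := hi a (le_lt_trans ra zd1) b (le_lt_trans rb zd'); rewrite /= in h2.
have ez : x + z *: v = x + a%:C *: v + b%:C *: ('i%C *: v).
  by rewrite -addrA scalerA -scalerDl [_ * 'i%C]mulrC -complexE.
rewrite ez.
have -> : z *: L = a%:C *: L + b%:C *: ('i%C *: L).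
  by rewrite scalerA -scalerDl [_ * 'i%C]mulrC -complexE.
move: h1 h2; set A := g (x + _ + _); set B := g (x + _); set C := g x.
move: ('i%C *: L) A B C => K A B C h1 h2.
have -> : A - C - (a%:C *: L + b%:C *: K) = (A - B - b%:C *: K) + (B - C - a%:C *: L).
  by module R[i].
apply: (le_lt_trans (normD hN _ _)); apply: (le_lt_trans (lerD h2 h1)).
have s : `|b| + `|a| <= 2 * complex.Re `|z| by rewrite mulr_natl mulr2n lerD.
rewrite -mulrDr mulrC; apply: (le_lt_trans (ler_wpM2r (ltW e40) s)).
have -> : 2 * complex.Re `|z| * (e / 4) = complex.Re `|z| * (e / 2) by field.
by rewrite ltr_pM2l // ltr_pdivrMr // ltr_pMr // ltr1n.
Qed.

Lemma C1_onD (g h : E -> F) (c : R[i]) : C1_on O g -> C1_on O h ->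
  C1_on O (fun y => g y + c *: h y).
Proof.
move=> gC1 hC1 x v Ox.
have key y w : O y -> has_rderive (fun y => g y + c *: h y) y w
    (rderive g y w + c *: rderive h y w).
  move=> Oy; apply: (has_rderiveD hN (rderivableP hN (gC1 y w Oy).1)).
  exact: has_rderiveZ (rderivableP hN (hC1 y w Oy).1).
split; first by eexists; exact: key.
have cg := (gC1 x v Ox).2; have ch := (hC1 x v Ox).2.
have cc : (fun=> c : R[i]^o) @ (x, v) --> (c : R[i]^o) by exact: cvg_cst.
have := @tvs_cvgD R F _ _ (nbhs_filter (x, v)) _ _ _ _ cg
   (@tvs_cvgZ R F _ _ (nbhs_filter (x, v)) _ _ _ _ cc ch).
rewrite /prop_for /continuous_at /= -(has_rderiveE hN (key x v Ox)).
apply: cvg_trans; apply: near_eq_cvg.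
have hO : \forall p \near (x, v), O p.1.
  have : (fun p : E * E => p.1) @ (x, v) --> x by exact: cvg_fst.
  by apply; exact: open_nbhs_nbhs.
apply: filterS hO => p Op.
by rewrite (has_rderiveE hN (key p.1 p.2 Op)).
Qed.

Lemma del_C1 (f : E -> F) v : C2_on O f -> C1_on O (fun y => del f y v).
Proof.
move=> fC2; have := C1_onD (- 'i%C) (C2_C1_rderive v fC2)
  (C2_C1_rderive ('i%C *: v) fC2).
by congr (C1_on _ _); apply/funext => y; rewrite /del scaleNr.
Qed.

Lemma del_continuous (f : E -> F) (C : E -> E) x : C2_on O f -> O x ->
  {for x, continuous C} -> {for x, continuous (fun y => del f y (C y))}.
Proof.
move=> fC2 Ox cC; have fC1 := C2_C1 fC2.
have cD (B : E -> E) : {for x, continuous B} ->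
    (fun y => rderive f y (B y)) @ x --> rderive f x (B x).
  move=> cB; have cp : (fun y => (y, B y)) @ x --> (x, B x).
    exact (cvg_pair cvg_id cB).
  exact (@cvg_comp _ _ _ (fun y => (y, B y)) (fun p : E * E => rderive f p.1 p.2)
    _ _ _ cp (fC1 x (B x) Ox).2).
have ci : {for x, continuous (fun y => 'i%C *: C y)}.
  exact (@tvs_cvgZ R E _ _ (nbhs_filter x) (fun=> 'i%C : R[i]^o) _ _ _ (cvg_cst _) cC).
have delE : (fun y => del f y (C y)) =
    (fun y => rderive f y (C y) + (- 'i%C) *: rderive f y ('i%C *: C y)).
  by apply/funext => y; rewrite /del scaleNr.
rewrite /prop_for /continuous_at /= (congr1 (@^~ x) delE) delE.
exact (@tvs_cvgD R F _ _ (nbhs_filter x) _ _ _ _ (cD _ cC)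
  (@tvs_cvgZ R F _ _ (nbhs_filter x) (fun=> - 'i%C : R[i]^o) _ _ _ (cvg_cst _) (cD _ ci))).
Qed.

Section LinearDirection.
Variables (C : E -> E).
Hypotheses (CD : forall x y, C (x + y) = C x + C y)
  (CZ : forall z x, C (z *: x) = z *: C x).

(** A product rule, meant for commutators as [C]. Along the line, [C] is affine, so the derivative
    in direction [C y] splits into the part along [C x], which yields the second derivative, and [t]
    times the part along [C v], which tends to [rderive f x (C v)] by joint continuity. *)
Lemma has_rderive_linear_direction (f : E -> F) x v : C2_on O f -> O x ->
  has_rderive (fun y => rderive f y (C y)) x v
    (rderive2 f x (C x) v + rderive f x (C v)).
Proof.
move=> fC2 Ox; have fC1 := C2_C1 fC2.
have := rderivableP hN (C2_C1_rderive (C x) fC2 v Ox).1.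
rewrite -/(rderive2 f x (C x) v) => /(cvg_normP hN) h1.
apply/(cvg_normP hN) => e e0; have e20 : 0 < e / 2 by rewrite divr_gt0.
have /(cvg_normP hN)/(_ _ e20) h2 := (fC1 x (C v) Ox).2.
have [d d0 hd] := near_line_pair v h2.
have /near_nbhs0P[d' d'0 hd'] := near_line v oO Ox.
have /near_dnbhs0P[d1 d10 hd1] := h1 _ e20.
apply/near_dnbhs0P; exists (Num.min d (Num.min d' d1)).
  by rewrite !lt_min d0 d'0.
move=> t t0; rewrite !lt_min => /and3P[td td' td1].
have := hd t td => /=; have := hd1 t t0 td1; have Oy := hd' t td'.
rewrite /rquot CD CZ; set y := x + t%:C *: v in Oy *.
rewrite (rderiveD hN oO (C x) (t%:C *: C v) fC1 Oy).
rewrite (rderive_scale hN t (fC1 y (C v) Oy).1).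
move: (rderive f y _) (rderive f x (C x)) (rderive f y (C v)) (rderive f x (C v))
  (rderive2 f x (C x) v) => a b c m l ha hb.
have -> : (t^-1)%:C *: (a + t%:C *: c - b) - (l + m)
   = ((t^-1)%:C *: (a - b) - l) + (c - m).
  have -> : c - m = (t^-1 * t)%:C *: c - m by rewrite mulVf // scale1r.
  by module R[i].
by rewrite (le_lt_trans (normD hN _ _)) // [ltRHS](splitr e) ltrD.
Qed.

(** The same product rule for complex increments: the part along the fixed direction [C x] converges
    by [cquot_CauchyRiemann], the part along [C v] by continuity of [del]. Analyticity of the
    conjugate rests on it. *)
Lemma cquot_linear_direction (f : E -> F) x v : pluriharmonic_on O f -> O x ->
  cquot (fun y => del f y (C y)) x v z @[z --> 0^'] -->
    del2 f x (C x) v + del f x (C v).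
Proof.
move=> ph Ox; have fC2 := ph.1.
have dE w : rderive (fun y => del f y (C x)) x w = del2 f x (C x) w.
  rewrite /del2.
  exact (has_rderiveE hN (has_rderive_del hN (v := C x) (w := w) fC2 Ox)).
have CR : rderive (fun y => del f y (C x)) x ('i%C *: v) =
    'i%C *: rderive (fun y => del f y (C x)) x v.
  by rewrite !dE (del2_ir hN oO ph _ _ Ox).
have := cquot_CauchyRiemann (del_C1 (C x) fC2) Ox CR; rewrite dE.
move=> /(cvg_normP hN) h1.
apply/(cvg_normP hN) => e e0; have e20 : 0 < e / 2 by rewrite divr_gt0.
have c2 : (fun y => del f y (C v)) @ x --> del f x (C v).
  exact: (del_continuous fC2 Ox (cvg_cst (C v))).
have n2 := (cvg_normP (FG := nbhs_filter x) hN _ _).1 c2 _ e20.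
have [d d0 hd] := complex_near_line v n2.
have nO : nbhs x O by exact: open_nbhs_nbhs.
have [d' d'0 hd'] := complex_near_line v nO.
have m0 : 0 < Num.min d d' by rewrite !lt_min d0.
apply: filterS2 (h1 _ e20) _ => [z|]; last first.
  apply: (near_complex_dnbhs0 m0) => z z0 zd; exact: (conj z0 zd).
move=> ha [z0]; rewrite lt_min => /andP[zd zd'].
have := hd z zd; have Oy := hd' z zd'; move: ha.
rewrite /cquot CD CZ; set y := x + z *: v in Oy *.
rewrite (delD hN oO ph (C x) (z *: C v) Oy) (delZ hN oO ph z (C v) Oy).
move: (del f y _) (del f x (C x)) (del f y (C v)) (del f x (C v))
  (del2 f x (C x) v) => a b c m l ha hb.
have -> : z^-1 *: (a + z *: c - b) - (l + m) = (z^-1 *: (a - b) - l) + (c - m).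
  have -> : c - m = (z^-1 * z) *: c - m by rewrite mulVf // scale1r.
  by module R[i].
by rewrite (le_lt_trans (normD hN _ _)) // [ltRHS](splitr e) ltrD.
Qed.

End LinearDirection.
End ComplexDerivatives.

(** * Matrices over a module *)

Section MatrixModules.
Context {R : realType}.

Section Topology.
Context {E : topologicalLmodType R[i]} {n : nat}.

Lemma tensmx_cvg {T : Type} (G : set_system T) {FG : Filter G}
    (f : T -> tensmx E n) (M : tensmx E n) :
  (forall i j, (f x i j) @[x --> G] --> M i j) -> f @ G --> M.
Proof.
move=> h S [P nP PS].
have : \forall x \near G, forall i j, P i j (f x i j).
  apply: filter_forall => i; apply: filter_forall => j; exact: h (nP i j).
by apply: filterS => x hx; exact: PS.
Qed.

Lemma tensmx_entry_cvg {T : Type} (G : set_system T) {FG : Filter G}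
    (f : T -> tensmx E n) (M : tensmx E n) i j :
  f @ G --> M -> (f x i j) @[x --> G] --> M i j.
Proof.
move=> h S nS.
have nM : nbhs M [set X : tensmx E n | S (X i j)].
  exists (fun i' j' => if (i' == i) && (j' == j) then S else setT).
    move=> i' j'; case: ifP => [/andP[/eqP-> /eqP->] //|_]; exact: filterT.
  by move=> X /(_ i j); rewrite !eqxx.
exact: h nM.
Qed.

Lemma tvs_cvg_sum {I : Type} (r : seq I) {T : Type} (G : set_system T)
    {FG : Filter G} (f : I -> T -> E) (l : I -> E) :
  (forall i, f i @ G --> l i) -> (\sum_(i <- r) f i x) @[x --> G] --> \sum_(i <- r) l i.
Proof.
move=> h; elim: r => [|a r IH].
  rewrite big_nil; have -> : (fun x => \sum_(i <- [::]) f i x) = fun=> 0.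
    by apply/funext => x; rewrite big_nil.
  exact: cvg_cst.
rewrite big_cons; have -> : (fun x => \sum_(i <- a :: r) f i x) =
    fun x => f a x + \sum_(i <- r) f i x.
  by apply/funext => x; rewrite big_cons.
exact (tvs_cvgD (h a) IH).
Qed.

Lemma tvs_cvgZl {T : Type} (G : set_system T) {FG : Filter G} (c : R[i])
    (f : T -> E) (a : E) : f @ G --> a -> (c *: f x) @[x --> G] --> c *: a.
Proof. exact (@tvs_cvgZ R E T G FG (fun=> c : R[i]^o) f c a (cvg_cst (c : R[i]^o))). Qed.

Lemma lactmx_continuous (V : 'M[R[i]]_n) : continuous (fun X : tensmx E n => lactmx V X).
Proof.
move=> X; apply: (tensmx_cvg (FG := nbhs_filter X)) => i j.
have -> : (fun x : tensmx E n => lactmx V x i j) = fun x => \sum_k V i k *: x k j.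
  by apply/funext => x; rewrite mxE.
rewrite mxE; apply: (tvs_cvg_sum (FG := nbhs_filter X)) => k.
apply: (tvs_cvgZl (FG := nbhs_filter X)).
exact: (tensmx_entry_cvg (FG := nbhs_filter X) (f := id)).
Qed.

Lemma ractmx_continuous (V : 'M[R[i]]_n) : continuous (fun X : tensmx E n => ractmx X V).
Proof.
move=> X; apply: (tensmx_cvg (FG := nbhs_filter X)) => i j.
have -> : (fun x : tensmx E n => ractmx x V i j) = fun x => \sum_k V k j *: x i k.
  by apply/funext => x; rewrite mxE.
rewrite mxE; apply: (tvs_cvg_sum (FG := nbhs_filter X)) => k.
apply: (tvs_cvgZl (FG := nbhs_filter X)).
exact: (tensmx_entry_cvg (FG := nbhs_filter X) (f := id)).
Qed.

End Topology.

Section Algebra.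
Context {E : lmodType R[i]} {n : nat}.
Implicit Types (X Y : tensmx E n) (V W K L : 'M[R[i]]_n) (c : R[i]).

Lemma tensmx_scaleE c X i j : (c *: X) i j = c *: X i j.
Proof. by rewrite mxE. Qed.

Lemma lactmxDr V X Y : lactmx V (X + Y) = lactmx V X + lactmx V Y.
Proof.
apply/matrixP => i j; rewrite !mxE -big_split; apply: eq_bigr => k _.
by rewrite mxE scalerDr.
Qed.

Lemma lactmxDl V W X : lactmx (V + W) X = lactmx V X + lactmx W X.
Proof.
apply/matrixP => i j; rewrite !mxE -big_split; apply: eq_bigr => k _.
by rewrite mxE scalerDl.
Qed.

Lemma lactmxZr c V X : lactmx V (c *: X) = c *: lactmx V X.
Proof.
apply/matrixP => i j; rewrite tensmx_scaleE !mxE scaler_sumr.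
by apply: eq_bigr => k _; rewrite tensmx_scaleE !scalerA mulrC.
Qed.

Lemma lactmxZl c V X : lactmx (c *: V) X = c *: lactmx V X.
Proof.
apply/matrixP => i j; rewrite tensmx_scaleE !mxE scaler_sumr.
by apply: eq_bigr => k _; rewrite mxE scalerA.
Qed.

Lemma ractmxDl V X Y : ractmx (X + Y) V = ractmx X V + ractmx Y V.
Proof.
apply/matrixP => i j; rewrite !mxE -big_split; apply: eq_bigr => k _.
by rewrite mxE scalerDr.
Qed.

Lemma ractmxDr V W X : ractmx X (V + W) = ractmx X V + ractmx X W.
Proof.
apply/matrixP => i j; rewrite !mxE -big_split; apply: eq_bigr => k _.
by rewrite mxE scalerDl.
Qed.

Lemma ractmxZl c V X : ractmx (c *: X) V = c *: ractmx X V.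
Proof.
apply/matrixP => i j; rewrite tensmx_scaleE !mxE scaler_sumr.
by apply: eq_bigr => k _; rewrite tensmx_scaleE !scalerA mulrC.
Qed.

Lemma ractmxZr c V X : ractmx X (c *: V) = c *: ractmx X V.
Proof.
apply/matrixP => i j; rewrite tensmx_scaleE !mxE scaler_sumr.
by apply: eq_bigr => k _; rewrite mxE scalerA.
Qed.

Lemma lactmx1 X : lactmx 1%:M X = X.
Proof.
apply/matrixP => i j; rewrite mxE (bigD1 i) //= mxE eqxx scale1r big1 ?addr0 //.
by move=> k ki; rewrite mxE eq_sym (negPf ki) scale0r.
Qed.

Lemma ractmx1 X : ractmx X 1%:M = X.
Proof.
apply/matrixP => i j; rewrite mxE (bigD1 j) //= mxE eqxx scale1r big1 ?addr0 //.
by move=> k ki; rewrite mxE (negPf ki) scale0r.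
Qed.

Lemma lactmxM V W X : lactmx (V *m W) X = lactmx V (lactmx W X).
Proof.
apply/matrixP => i j; rewrite !mxE.
under eq_bigr => k _ do rewrite mxE scaler_suml.
rewrite exchange_big; apply: eq_bigr => k _; rewrite mxE scaler_sumr.
by apply: eq_bigr => l _; rewrite scalerA.
Qed.

Lemma ractmxM V W X : ractmx X (V *m W) = ractmx (ractmx X V) W.
Proof.
apply/matrixP => i j; rewrite !mxE.
under eq_bigr => k _ do rewrite mxE scaler_suml.
rewrite exchange_big; apply: eq_bigr => k _; rewrite mxE scaler_sumr.
by apply: eq_bigr => l _; rewrite scalerA mulrC.
Qed.

Lemma lractmxC V W X : lactmx V (ractmx X W) = ractmx (lactmx V X) W.
Proof.
apply/matrixP => i j; rewrite !mxE.
under eq_bigr => k _ do rewrite mxE scaler_sumr.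
rewrite exchange_big; apply: eq_bigr => k _; rewrite mxE scaler_sumr.
by apply: eq_bigr => l _; rewrite !scalerA mulrC.
Qed.

Lemma ractmx_delta X a b i j :
  ractmx X (delta_mx a b) i j = if j == b then X i a else 0.
Proof.
rewrite mxE (bigD1 a) //= big1 => [|k ka].
  by rewrite mxE eqxx /= addr0; case: eqP => _; rewrite ?scale1r ?scale0r.
by rewrite mxE (negPf ka) scale0r.
Qed.

Lemma lactmx_delta X a b i j :
  lactmx (delta_mx a b) X i j = if i == a then X b j else 0.
Proof.
rewrite mxE (bigD1 b) //= big1 => [|k ka].
  by rewrite mxE eqxx andbT addr0; case: eqP => _; rewrite ?scale1r ?scale0r.
by rewrite mxE (negPf ka) andbF scale0r.
Qed.

Definition commutator X K : tensmx E n := ractmx X K - lactmx K X.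

Lemma commutatorDl X Y K : commutator (X + Y) K = commutator X K + commutator Y K.
Proof. by rewrite /commutator ractmxDl lactmxDr opprD addrACA. Qed.

Lemma commutatorZl c X K : commutator (c *: X) K = c *: commutator X K.
Proof. by rewrite /commutator ractmxZl lactmxZr scalerBr. Qed.

Lemma commutatorDr X K L : commutator X (K + L) = commutator X K + commutator X L.
Proof. by rewrite /commutator ractmxDr lactmxDl opprD addrACA. Qed.

Lemma commutatorZr c X K : commutator X (c *: K) = c *: commutator X K.
Proof. by rewrite /commutator ractmxZr lactmxZl scalerBr. Qed.

Lemma commutatorBr X K L : commutator X (K - L) = commutator X K - commutator X L.
Proof. by rewrite commutatorDr -scaleN1r commutatorZr scaleN1r. Qed.

Lemma commutator_jacobi X K L :
  commutator (commutator X L) K - commutator (commutator X K) L =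
  commutator X (L *m K - K *m L).
Proof.
have e (M P : 'M[R[i]]_n) : commutator (commutator X M) P =
    ractmx (ractmx X M) P - ractmx (lactmx M X) P - ractmx (lactmx P X) M
    + lactmx P (lactmx M X).
  rewrite /commutator -[in LHS](scaleN1r (lactmx M X)) ractmxDl ractmxZl lactmxDr lactmxZr.
  rewrite lractmxC; module R[i].
rewrite !e commutatorBr /commutator.
by rewrite !ractmxM !lactmxM; module R[i].
Qed.

End Algebra.

End MatrixModules.

(** * The entrywise norm and the adjoint of matrices *)

Section MatrixNorm.
Context {R : realType} {A : cstarAlgType R}.
Local Open Scope sesquilinear_scope.

Lemma ReD (x y : R[i]) : complex.Re (x + y) = complex.Re x + complex.Re y.
Proof. by case: x; case: y. Qed.

Lemma Re_le (x y : R[i]) : x <= y -> complex.Re x <= complex.Re y.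
Proof. by rewrite lecE => /andP[]. Qed.

Lemma real_complex_Re_norm {V : normedZmodType R[i]} (a : V) : (complex.Re `|a|)%:C = `|a|.
Proof. by rewrite RRe_real ?normr_real. Qed.

Lemma Re_norm_ge0 (a : A) : 0 <= complex.Re `|a|.
Proof. exact: Re_le (normr_ge0 a). Qed.

(** The sum of the entry norms, rather than an operator norm: it visibly induces the product
    topology and is invariant under [adjmx]. *)
Definition mxnorm {n} (M : tensmx A n) : R := \sum_i \sum_j complex.Re `|M i j|.

Lemma entry_le_mxnorm {n} (M : tensmx A n) i j : complex.Re `|M i j| <= mxnorm M.
Proof.
rewrite /mxnorm (bigD1 i) //= (bigD1 j) //= -addrA lerDl addr_ge0 ?sumr_ge0 //.
  by move=> k _; exact: Re_norm_ge0.
by move=> k _; rewrite sumr_ge0 // => l _; exact: Re_norm_ge0.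
Qed.

Lemma mxnorm_compatible n : compatible_norm (@mxnorm n).
Proof.
split.
- move=> a b; rewrite /mxnorm -big_split ler_sum // => i _.
  rewrite -big_split ler_sum // => j _ /=.
  by rewrite -ReD mxE; apply: Re_le; exact: ler_normD.
- move=> z a; rewrite /mxnorm mulr_sumr; apply: eq_bigr => i _.
  rewrite mulr_sumr; apply: eq_bigr => j _; rewrite tensmx_scaleE normrZ.
  by rewrite -[in LHS]real_complex_Re_norm -(real_complex_Re_norm (a i j)) -rmorphM.
- move=> a a0; apply/matrixP => i j; rewrite [RHS]mxE; apply/eqP.
  rewrite -normr_eq0 -real_complex_Re_norm.
  have -> : complex.Re `|a i j| = 0; last by [].
  by apply/eqP; rewrite eq_le Re_norm_ge0 andbT -a0 entry_le_mxnorm.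
- move=> a S; split=> [[P nP PS]|[e e0 eS]].
    have : \forall e \near (0 : R)^'+, forall i j b,
        complex.Re `|b - a i j| < e -> P i j b.
      apply: filter_forall => i; apply: filter_forall => j.
      have /nbhs_ballP[d] := nP i j.
      rewrite /= ltcE => /andP[/= /eqP di d0] hd.
      near=> e => b bd; apply: hd; rewrite -ball_normE /ball_ /= distrC.
      rewrite -real_complex_Re_norm ltcE /= -di eqxx /=.
      by apply: lt_le_trans bd _; near: e; exact: nbhs_right_le.
    move=> /(filterI (nbhs_right_gt 0)) /filter_ex[e [e0 he]].
    exists e => // b bd; apply: PS => i j; apply: he.
    apply: le_lt_trans bd; have := entry_le_mxnorm (b - a) i j.
    by rewrite !mxE.
  (* The successor keeps the denominator nonzero for [n = 0] and makes the sum of [n * n] such terms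
     strictly less than [e]. *)
  exists (fun i j => [set b | complex.Re `|b - a i j| < e / (n * n).+1%:R]).
    move=> i j; apply/nbhs_ballP; exists (e / (n * n).+1%:R)%:C.
      by rewrite /= ltcR divr_gt0.
    move=> b; rewrite -ball_normE /ball_ /= distrC -real_complex_Re_norm.
    by rewrite ltcR.
  move=> b hb; apply: eS; rewrite /mxnorm.
  apply: (@le_lt_trans _ _ (\sum_(i < n) \sum_(j < n) e / (n * n).+1%:R)).
    apply: ler_sum => i _; apply: ler_sum => j _; rewrite !mxE ltW //.
    exact: hb.
  rewrite !sumr_const !card_ord -mulrnA -[ltLHS]mulr_natr mulrAC ltr_pdivrMr ?ltr0n //.
  by rewrite ltr_pM2l // ltr_nat.
Unshelve. all: by end_near.
Qed.

Lemma adj0 : adj (0 : A) = 0.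
Proof. by apply: (addrI (adj 0)); rewrite -adjD !addr0. Qed.

Lemma adj_sum {I : Type} (r : seq I) (F : I -> A) :
  adj (\sum_(i <- r) F i) = \sum_(i <- r) adj (F i).
Proof. by elim/big_rec2: _ => [|i x y _ <-]; [exact: adj0|exact: adjD]. Qed.

(** The C*-identity and submultiplicativity bound the square of the norm of [b] by the product of
    the norms of [adj b] and [b]; apply this to [a] and to [adj a]. *)
Lemma norm_adj (a : A) : `|adj a| = `|a|.
Proof.
have h (b : A) : `|b| <= `|adj b|.
  have [->|b0] := eqVneq b 0; first by rewrite normr0.
  rewrite -(@ler_pM2r _ `|b|) ?normr_gt0 // -expr2 -cstar_normE.
  exact: cstar_normM.
by apply/eqP; rewrite eq_le h andbT -{2}[a]adjK h.
Qed.

Lemma mxnorm_adjmx n (M : tensmx A n) : mxnorm (adjmx M) = mxnorm M.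
Proof.
rewrite /mxnorm exchange_big; apply: eq_bigr => i _; apply: eq_bigr => j _.
by rewrite mxE norm_adj.
Qed.

Section Adjoint.
Context {n : nat}.
Implicit Types (X Y : tensmx A n) (V : 'M[R[i]]_n) (c : R[i]).

Lemma adjmxD X Y : adjmx (X + Y) = adjmx X + adjmx Y.
Proof. by apply/matrixP => i j; rewrite !mxE adjD. Qed.

Lemma adjmxZ c X : adjmx (c *: X) = c^*%C *: adjmx X.
Proof. by apply/matrixP => i j; rewrite mxE !tensmx_scaleE mxE Defs.adjZ. Qed.

Lemma adjmxN X : adjmx (- X) = - adjmx X.
Proof. by rewrite -scaleN1r adjmxZ rmorphN rmorph1 scaleN1r. Qed.

Lemma adjmxB X Y : adjmx (X - Y) = adjmx X - adjmx Y.
Proof. by rewrite adjmxD adjmxN. Qed.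

Lemma adjmx_lactmx V X : adjmx (lactmx V X) = ractmx (adjmx X) (V^t*).
Proof.
apply/matrixP => i j; rewrite !mxE adj_sum; apply: eq_bigr => k _.
by rewrite !mxE Defs.adjZ.
Qed.

Lemma adjmx_ractmx V X : adjmx (ractmx X V) = lactmx (V^t*) (adjmx X).
Proof.
apply/matrixP => i j; rewrite !mxE adj_sum; apply: eq_bigr => k _.
by rewrite !mxE Defs.adjZ.
Qed.

Lemma adjmx_commutator X V :
  adjmx (commutator X V) = - commutator (adjmx X) (V^t*).
Proof. by rewrite /commutator adjmxB adjmx_lactmx adjmx_ractmx opprB. Qed.

End Adjoint.

Lemma selfadjoint_limit {n} {T : Type} (G : set_system T) {FG : ProperFilter G}
    (f : T -> tensmx A n) (l : tensmx A n) :
  (\forall x \near G, selfadjoint (f x)) -> f @ G --> l -> selfadjoint l.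
Proof.
have hN := mxnorm_compatible n.
move=> sf /(cvg_normP hN) fl; apply/eqP; rewrite -subr_eq0; apply/eqP.
apply: (norm_le_eq0 hN) => e e0; have e20 : 0 < e / 2 by rewrite divr_gt0.
have [x [sx xe]] := filter_ex (filterI sf (fl _ e20)).
apply: (le_trans (normB_le hN _ (f x) _)).
rewrite -{1}sx -adjmxB mxnorm_adjmx [mxnorm (l - f x)](normBC hN).
rewrite [in leRHS](splitr e); exact: (lerD (ltW xe) (ltW xe)).
Qed.

End MatrixNorm.

(** * Differentiating unitary equivariance *)

Section UnitaryCurves.
Context {R : realType} {n : nat}.
Local Open Scope sesquilinear_scope.
Variable H : 'M[R[i]]_n.
Hypotheses (HA : H^t* = H) (HHH : H *m H *m H = H).

(* A Cayley-type parametrization of exp (i theta H), where s is the sine of theta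
   and t the tangent of theta / 2. *)
Definition cayley (s t : R) : 'M[R[i]]_n :=
  1%:M + s%:C *: ('i%C *: H - t%:C *: (H *m H)).

Lemma cayley_adj s t :
  (cayley s t)^t* = 1%:M - s%:C *: ('i%C *: H + t%:C *: (H *m H)).
Proof.
have HE a b : Num.conj (H b a) = H a b by rewrite -[in RHS]HA !mxE.
have HHA : (H *m H)^t* = H *m H by rewrite trmx_mul map_mxM HA.
have HHE a b : Num.conj ((H *m H) b a) = (H *m H) a b by rewrite -[in RHS]HHA !mxE.
apply/matrixP => a b; rewrite /cayley; move: (H *m H) HHE => HH HHE.
rewrite !mxE !(rmorphD, rmorphM, rmorphN) /= HE HHE.
have -> : Num.conj 'i%C = - 'i%C :> R[i] by apply/eqP; rewrite eq_complex /= oppr0 !eqxx.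
have cR (x : R) : Num.conj x%:C = x%:C :> R[i] by apply/eqP; rewrite eq_complex /= oppr0 !eqxx.
rewrite !cR rmorph_nat eq_sym; ring.
Qed.

(** The hypothesis expresses the sine through the tangent of the half angle. As the fourth power of
    [H] is its square, the product with the adjoint is [1] plus a multiple of [H *m H], with
    coefficient [s * (s * (1 + t * t) - 2 * t)]. *)
Lemma cayley_unitary s t : s * (1 + t * t) = 2 * t -> cayley s t \is unitarymx.
Proof.
move=> st; apply/unitarymxP; rewrite cayley_adj /cayley.
have HHHH : H *m H *m (H *m H) = H *m H by rewrite mulmxA HHH.
have HHHr : H *m (H *m H) = H by rewrite mulmxA.
have -> : (1%:M + s%:C *: ('i%C *: H - t%:C *: (H *m H))) *m
    (1%:M - s%:C *: ('i%C *: H + t%:C *: (H *m H))) =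
    1%:M + (s%:C * s%:C * (- ('i%C * 'i%C) + t%:C * t%:C) - 2 * s%:C * t%:C) *: (H *m H).
  rewrite mulmxDl !mulmxDr !mul1mx !mulmx1 mulmxN -!scalemxAl -!scalemxAr.
  rewrite mulmxDl !mulmxDr !mulNmx -!scalemxAl -!scalemxAr HHH HHHr HHHH.
  by module R[i].
rewrite mulCii opprK.
have -> : s%:C * s%:C * (1 + t%:C * t%:C) - 2 * s%:C * t%:C =
    (s * (s * (1 + t * t) - 2 * t))%:C :> R[i].
  rewrite !(rmorphM, rmorphB, rmorphD, rmorph1, rmorph_nat); ring.
by rewrite st subrr mulr0 scale0r addr0.
Qed.

(** The difference quotient of the unitary orbit of [X] with respect to [s], expanded so that no
    division by [s] occurs; at [s = t = 0] only the commutator term is left. *)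
Definition cayley_chord {E : lmodType R[i]} (s t : R) (X : tensmx E n) : tensmx E n :=
  'i%C *: commutator X H
  + t%:C *: (- (ractmx X (H *m H) + lactmx (H *m H) X))
  + s%:C *: ractmx (lactmx H X) H
  + (s * t)%:C *: ('i%C *: (ractmx (lactmx H X) (H *m H) - ractmx (lactmx (H *m H) X) H))
  + (s * (t * t))%:C *: ractmx (lactmx (H *m H) X) (H *m H).

Lemma cayley_conj {E : lmodType R[i]} s t (X : tensmx E n) :
  unitary_conj (cayley s t) X = X + s%:C *: cayley_chord s t X.
Proof.
rewrite /unitary_conj cayley_adj /cayley /cayley_chord /commutator.
rewrite !(lactmxDl, lactmxZl, ractmxDr, ractmxZr, ractmxDl, ractmxZl, lactmx1, ractmx1).
have lN V : lactmx (- V) X = - lactmx V X by rewrite -scaleN1r lactmxZl scaleN1r.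
have rN Y V : ractmx Y (- V) = - ractmx Y V by rewrite -scaleN1r ractmxZr scaleN1r.
have rNl Y V : ractmx (- Y) V = - ractmx Y V by rewrite -scaleN1r ractmxZl scaleN1r.
rewrite !(lN, rN, rNl, lactmxDl, lactmxZl, ractmxDr, ractmxZr, ractmxDl, ractmxZl, ractmx1).
set P := ractmx (lactmx H X) H.
(* One copy of [P] carries the square of ['i], made explicit for [module]. *)
have {2}-> : P = - ('i%C * 'i%C) *: P by rewrite mulCii opprK scale1r.
by module R[i].
Qed.

End UnitaryCurves.

Section Equivariance.
Context {R : realType} {E : topologicalLmodType R[i]} {A : cstarAlgType R} {n : nat}.
Local Open Scope sesquilinear_scope.
Let hN := @mxnorm_compatible R A n.

Variables (O : set (tensmx E n)) (f : tensmx E n -> tensmx A n).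
Hypotheses (oO : open O) (ph : pluriharmonic_on O f)
  (sa : forall X, O X -> selfadjoint (f X))
  (equiv : forall V X, V \is unitarymx -> O X ->
     f (unitary_conj V X) = unitary_conj V (f X)).

Lemma rderive_selfadjoint Z v : O Z -> selfadjoint (rderive f Z v).
Proof.
move=> OZ; have := rderivableP hN (C2_C1 ph.1 v OZ).1.
apply: selfadjoint_limit.
have := near_line v oO OZ; rewrite near_nbhs0P => -[d d0 h].
apply/near_dnbhs0P; exists d => // t _ td; rewrite /selfadjoint /rquot adjmxZ.
by have := sa OZ; have := sa (h t td); rewrite /selfadjoint conjc_real adjmxB => -> ->.
Qed.

Lemma cayley_sine_cvg : (2 * t / (1 + t * t) : R) @[t --> (0 : R)] --> (0 : R).
Proof.
have c : (2 * t : R) @[t --> (0 : R)] --> 2 * (0 : R).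
  by apply: cvgM; [exact: cvg_cst|exact: cvg_id].
have d : (1 + t * t : R) @[t --> (0 : R)] --> 1 + (0 : R) * 0.
  by apply: cvgD; [exact: cvg_cst|apply: cvgM; exact: cvg_id].
have n0 : 1 + 0 * 0 != 0 :> R by rewrite mulr0 addr0 oner_neq0.
have := cvgM c (cvgV n0 d).
have -> : 2 * 0 * (1 + 0 * 0)^-1 = 0 :> R by rewrite mulr0 mul0r.
exact.
Qed.

Lemma cayley_chord_cvg {V : topologicalLmodType R[i]} (H : 'M[R[i]]_n) (X : tensmx V n) :
  cayley_chord H (2 * t / (1 + t * t)) t X @[t --> (0 : R)] --> 'i%C *: commutator X H.
Proof.
pose s (t : R) := 2 * t / (1 + t * t).
have cs : s t @[t --> (0 : R)] --> (0 : R) := cayley_sine_cvg.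
have ci : t @[t --> (0 : R)] --> (0 : R) by exact: cvg_id.
have cst : s t * t @[t --> (0 : R)] --> (0 : R).
  by have := cvgM cs ci; rewrite mulr0; apply.
have cstt : s t * (t * t) @[t --> (0 : R)] --> (0 : R).
  by have := cvgM cs (cvgM ci ci); rewrite !mulr0; apply.
have cC (c : R -> R) (M : tensmx V n) : c t @[t --> (0 : R)] --> (0 : R) ->
    ((c t)%:C *: M) @[t --> (0 : R)] --> (0 : tensmx V n).
  move=> c0.
  have c1 : ((c t)%:C : R[i]^o) @[t --> (0 : R)] --> (0%:C : R[i]^o).
    exact (@cvg_comp _ _ _ c (fun t : R => (t%:C : R[i]^o)) _ _ _ c0
      (@real_complex_continuous R 0)).
  have := @tvs_cvgZ R _ _ _ (nbhs_filter (0 : R)) _ _ _ _ c1 (cvg_cst M).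
  by rewrite scale0r; apply.
have F0 := nbhs_filter (0 : R).
pose M := 'i%C *: commutator X H.
have := @tvs_cvgD R _ _ _ F0 _ _ _ _ (@tvs_cvgD R _ _ _ F0 _ _ _ _
  (@tvs_cvgD R _ _ _ F0 _ _ _ _ (@tvs_cvgD R _ _ _ F0 _ _ _ _ (cvg_cst M)
  (cC id (- (ractmx X (H *m H) + lactmx (H *m H) X)) ci))
  (cC s (ractmx (lactmx H X) H) cs))
  (cC _ ('i%C *: (ractmx (lactmx H X) (H *m H) - ractmx (lactmx (H *m H) X) H)) cst))
  (cC _ (ractmx (lactmx (H *m H) X) (H *m H)) cstt).
rewrite !addr0; exact.
Qed.

Definition inner_derivative (H : 'M[R[i]]_n) := forall Z, O Z ->
  rderive f Z ('i%C *: commutator Z H) = 'i%C *: commutator (f Z) H.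

(** By equivariance, [f] sends [Z] plus [s] times its chord to [f Z] plus [s] times the chord of
    [f Z]. After division by [s] the right side tends to the commutator with [f Z]; on the left the
    direction itself moves with [t], and [strict_derivative] is uniform in it. *)
Lemma inner_derivative_hermitian (H : 'M[R[i]]_n) :
  H^t* = H -> H *m H *m H = H -> inner_derivative H.
Proof.
move=> HA HHH Z OZ; set v := 'i%C *: commutator Z H; set L := rderive f Z v.
pose s (t : R) := 2 * t / (1 + t * t).
have st t : s t * (1 + t * t) = 2 * t.
  by rewrite /s divfK // gt_eqF // -expr2 ltr_pwDl // sqr_ge0.
have F0 : ProperFilter ((0 : R)^') by exact: Proper_dnbhs_numFieldType.
have hl : cayley_chord H (s t) t (f Z) @[t --> (0 : R)^'] --> 'i%C *: commutator (f Z) H.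
  move=> P nP; have /near_nbhs0P[d d0 h] := cayley_chord_cvg nP.
  by apply/near_dnbhs0P; exists d => // t _; exact: h.
apply: (norm_cvg_unique (FG := F0) hN _ hl).
apply/(cvg_normP (FG := _) hN) => e e0; have e20 : 0 < e / 2 by rewrite divr_gt0.
have [d d0 nd] := strict_derivative hN v oO (C2_C1 ph.1) OZ e20.
have cp : (fun t => (Z, cayley_chord H (s t) t Z)) @ (0 : R) --> (Z, v).
  exact (cvg_pair (cvg_cst Z) (@cayley_chord_cvg _ H Z)).
have /near_nbhs0P[d1 d10 h1] := cp _ nd.
have /near_nbhs0P[d2 d20 h2] : \forall t \near (0 : R), `|s t| < d.
  have /cvgrPdist_lt/(_ _ d0) := cayley_sine_cvg.
  by apply: filterS => t; rewrite sub0r normrN.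
apply/near_dnbhs0P; exists (Num.min d1 d2); first by rewrite lt_min d10.
move=> t t0; rewrite lt_min => /andP[td1 td2].
have := h1 t td1 (s t) (h2 t td2) => /=; rewrite -/L.
rewrite -(cayley_conj HA) equiv //; last exact: cayley_unitary.
rewrite (cayley_conj HA) [f Z + _]addrC addrK -scalerBr (normRZ hN) mulrC.
(* The estimate is divided by the parameter [s t] of the curve, not by [t]. *)
have s0 : s t != 0.
  apply: contra_neq t0 => s0; have := st t; rewrite s0 mul0r => /esym/eqP.
  by rewrite mulf_eq0 pnatr_eq0 /= => /eqP.
rewrite ler_pM2r ?normr_gt0 // => h; apply: (le_lt_trans h).
by rewrite ltr_pdivrMr // ltr_pMr // ltr1n.
Qed.

End Equivariance.

(** * From hermitian to arbitrary scalar matrices: the adjoint and Lie rules *)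

Section InnerDerivations.
Context {R : realType} {E : topologicalLmodType R[i]} {A : cstarAlgType R} {n : nat}.
Local Open Scope sesquilinear_scope.
Let hN := @mxnorm_compatible R A n.

Lemma has_rderive_linear {V : topologicalLmodType R[i]} {F G : topologicalLmodType R[i]}
    (L : F -> G) (f : V -> F) x v l :
  continuous L -> (forall a b, L (a + b) = L a + L b) ->
  (forall c a, L (c *: a) = c *: L a) ->
  has_rderive f x v l -> has_rderive (fun y => L (f y)) x v (L l).
Proof.
move=> cL LD LZ h; rewrite /has_rderive.
have -> : rquot (fun y => L (f y)) x v = fun t => L (rquot f x v t).
  by apply/funext => t; rewrite /rquot /= LZ LD -scaleN1r -LZ scaleN1r.
exact (@cvg_comp _ _ _ (rquot f x v) L _ _ _ h (cL l)).
Qed.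

Lemma commutator_continuous {V : topologicalLmodType R[i]} (K : 'M[R[i]]_n) :
  continuous (fun X : tensmx V n => commutator X K).
Proof.
move=> X; rewrite /continuous_at /commutator -scaleN1r.
have -> : (fun X : tensmx V n => ractmx X K - lactmx K X) =
    (fun X : tensmx V n => ractmx X K + (-1) *: lactmx K X).
  by apply/funext => Y; rewrite scaleN1r.
exact (@tvs_cvgD R _ _ _ (nbhs_filter X) _ _ _ _ (@ractmx_continuous _ _ _ K X)
  (@tvs_cvgZl _ _ _ _ (nbhs_filter X) _ _ _ (@lactmx_continuous _ _ _ K X))).
Qed.

Variables (O : set (tensmx E n)) (f : tensmx E n -> tensmx A n).
Hypotheses (oO : open O) (ph : pluriharmonic_on O f)
  (sa : forall X, O X -> selfadjoint (f X))
  (equiv : forall V X, V \is unitarymx -> O X ->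
     f (unitary_conj V X) = unitary_conj V (f X)).

Definition del_commutator (Z : tensmx E n) (K : 'M[R[i]]_n) : tensmx A n :=
  del f Z (commutator Z K).

(** Stated with both [K^t*] and the outer adjoint so that each side is complex linear in [K]; it
    then extends from hermitian [K] to all [K]. *)
Definition real_part_rule (K : 'M[R[i]]_n) := forall Z, O Z ->
  del_commutator Z K - adjmx (del_commutator Z (K^t*)) = 2 *: commutator (f Z) K.

(** The holomorphic derivative of [inner_derivative] along [G]. Unlike [inner_derivative] itself, it
    is complex linear in [K]. *)
Definition leibniz_rule (K : 'M[R[i]]_n) := forall Z G, O Z ->
  del2 f Z (commutator Z K) G + del f Z (commutator G K) = commutator (del f Z G) K.

Lemma del_commutatorD Z K L : O Z ->
  del_commutator Z (K + L) = del_commutator Z K + del_commutator Z L.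
Proof. by move=> OZ; rewrite /del_commutator commutatorDr (delD hN oO ph). Qed.

Lemma del_commutatorZ Z c K : O Z ->
  del_commutator Z (c *: K) = c *: del_commutator Z K.
Proof. by move=> OZ; rewrite /del_commutator commutatorZr (delZ hN oO ph). Qed.

(** Here [del_commutator Z H] is the real derivative along [[Z, H]] plus [[f Z, H]]. The first term
    is self-adjoint and the second skew-adjoint when [H] is hermitian, so subtracting the adjoint
    doubles the second. *)
Lemma inner_derivative_real_part (H : 'M[R[i]]_n) :
  H^t* = H -> inner_derivative O f H -> real_part_rule H.
Proof.
move=> HA I Z OZ; rewrite HA /del_commutator /del I // scalerA mulCii scaleN1r opprK.
rewrite adjmxD (rderive_selfadjoint oO ph sa) // adjmx_commutator HA sa //.
by module R[i].
Qed.

(** Both sides of the identity for [H] are differentiated in [Z], along [G] and along ['i G]; the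
    combination that defines [del] then gives the rule up to a factor ['i]. *)
Lemma inner_derivative_leibniz (H : 'M[R[i]]_n) :
  inner_derivative O f H -> leibniz_rule H.
Proof.
move=> I Z G OZ; have fC2 := ph.1; have fC1 := C2_C1 fC2.
pose C (y : tensmx E n) := 'i%C *: commutator y H.
have CD x y : C (x + y) = C x + C y by rewrite /C commutatorDl scalerDr.
have CZ c x : C (c *: x) = c *: C x.
  by rewrite /C commutatorZl !scalerA mulrC.
have key v : rderive2 f Z (C Z) v + rderive f Z (C v) =
    'i%C *: commutator (rderive f Z v) H.
  have h1 := has_rderive_linear_direction hN oO CD CZ (v := v) fC2 OZ.
  have hf := rderivableP hN (fC1 Z v OZ).1.
  have h2 : has_rderive (fun y => 'i%C *: commutator (f y) H) Z v
      ('i%C *: commutator (rderive f Z v) H).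
    apply: has_rderiveZ; apply: (has_rderive_linear (L := fun X => commutator X H)) => //.
    - exact: commutator_continuous.
    - by move=> a b; rewrite commutatorDl.
    - by move=> c a; rewrite commutatorZl.
  apply: (has_rderive_unique hN _ h2); apply: (has_rderive_near hN _ h1).
  have [d d0 hd] := (near_nbhs0P _).1 (near_line v oO OZ).
  by apply/near_nbhs0P; exists d => // t /hd Ot; rewrite I.
have k1 := key G; have k2 := key ('i%C *: G).
have CiG : C ('i%C *: G) = 'i%C *: C G by rewrite CZ.
(* Moving ['i] from the second direction to the first produces exactly the second term of [del2]. *)
rewrite CiG -(rderive2_i hN oO ph (C Z) G OZ) in k2.
have e : del2 f Z (C Z) G + del f Z (C G) = 'i%C *: commutator (del f Z G) H.
  have lin (a b : tensmx A n) : 'i%C *: commutator (a - 'i%C *: b) H =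
      'i%C *: commutator a H - 'i%C *: ('i%C *: commutator b H).
    by rewrite commutatorDl -[- ('i%C *: b)]scaleNr commutatorZl; module R[i].
  refine (etrans _ (etrans (congr2 (fun x y : tensmx A n => x - 'i%C *: y) k1 k2)
    (esym (lin (rderive f Z G) (rderive f Z ('i%C *: G)))))).
  by rewrite /del2 /del [in RHS]scalerDr [in RHS]opprD addrACA.
rewrite /C (del2Zl hN oO ph) // (delZ hN oO ph) // -scalerDr in e.
have i0 : 'i%C != 0 :> R[i] by rewrite eq_complex /= oner_eq0 andbF.
exact: (scalerI i0 e).
Qed.

Lemma ctmxD (K L : 'M[R[i]]_n) : (K + L)^t* = K^t* + L^t*.
Proof. by apply/matrixP => i j; rewrite !mxE rmorphD. Qed.

Lemma ctmxZ c (K : 'M[R[i]]_n) : (c *: K)^t* = Num.conj c *: K^t*.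
Proof. by apply/matrixP => i j; rewrite !mxE rmorphM. Qed.

Lemma real_part_ruleD K L :
  real_part_rule K -> real_part_rule L -> real_part_rule (K + L).
Proof.
move=> hK hL Z OZ; rewrite ctmxD !del_commutatorD // adjmxD.
by rewrite commutatorDr scalerDr -hK // -hL // opprD addrACA.
Qed.

Lemma real_part_ruleZ c K : real_part_rule K -> real_part_rule (c *: K).
Proof.
move=> hK Z OZ; rewrite ctmxZ !del_commutatorZ // adjmxZ.
have -> : (Num.conj c)^*%C = c by exact: conjcK.
by rewrite -scalerBr hK // commutatorZr !scalerA mulrC.
Qed.

Lemma leibniz_ruleD K L : leibniz_rule K -> leibniz_rule L -> leibniz_rule (K + L).
Proof.
move=> hK hL Z G OZ; rewrite !commutatorDr (delD hN oO ph (commutator G K) (commutator G L) OZ).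
rewrite (del2Dl hN oO ph (commutator Z K) (commutator Z L) G OZ).
exact (etrans (addrACA _ _ _ _) (congr2 +%R (hK Z G OZ) (hL Z G OZ))).
Qed.

Lemma leibniz_ruleZ c K : leibniz_rule K -> leibniz_rule (c *: K).
Proof.
move=> hK Z G OZ; rewrite !commutatorZr (delZ hN oO ph c (commutator G K) OZ).
rewrite (del2Zl hN oO ph (commutator Z K) G c OZ).
exact (etrans (esym (scalerDr _ _ _)) (congr1 ( *:%R c) (hK Z G OZ))).
Qed.

Lemma delta_mx_adj (a b : 'I_n) : (delta_mx a b : 'M[R[i]]_n)^t* = delta_mx b a.
Proof. by rewrite trmx_delta map_delta_mx. Qed.

Lemma rules_hermitian (H : 'M[R[i]]_n) : H^t* = H -> H *m H *m H = H ->
  real_part_rule H /\ leibniz_rule H.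
Proof.
move=> HA HHH; have I := inner_derivative_hermitian oO ph equiv HA HHH.
by split; [exact: inner_derivative_real_part|exact: inner_derivative_leibniz].
Qed.

(* The hermitian partial isometries E_ab + E_ba, i (E_ab - E_ba) and E_aa span all
   matrices over C. *)
Lemma rules_delta (a b : 'I_n) :
  real_part_rule (delta_mx a b) /\ leibniz_rule (delta_mx a b).
Proof.
have [<-|ab] := eqVneq a b.
  apply: rules_hermitian; first exact: delta_mx_adj.
  by rewrite !mul_delta_mx.
pose H1 : 'M[R[i]]_n := delta_mx a b + delta_mx b a.
pose W : 'M[R[i]]_n := delta_mx a b - delta_mx b a.
have ba : b != a by rewrite eq_sym.
have mm (i j k l : 'I_n) : delta_mx i j *m delta_mx k l =
    if j == k then delta_mx i l else 0 :> 'M[R[i]]_n.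
  by rewrite mul_delta_mx_cond; case: (j == k).
have [r1 l1] : real_part_rule H1 /\ leibniz_rule H1.
  apply: rules_hermitian; first by rewrite ctmxD !delta_mx_adj addrC.
  rewrite /H1 !(mulmxDl, mulmxDr) !mm !eqxx (negPf ab) (negPf ba).
  by rewrite !(mul0mx, mulmxDl, mm) !eqxx (negPf ab) (negPf ba) !(add0r, addr0, mul0mx) ?mm ?eqxx.
have [r2 l2] : real_part_rule ('i%C *: W) /\ leibniz_rule ('i%C *: W).
  apply: rules_hermitian.
    rewrite ctmxZ /W -[- delta_mx b a]scaleN1r ctmxD ctmxZ !delta_mx_adj.
    have -> : Num.conj 'i%C = - 'i%C :> R[i] by apply/eqP; rewrite eq_complex /= oppr0 !eqxx.
    have -> : Num.conj (-1) = -1 :> R[i] by rewrite rmorphN rmorph1.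
    by module R[i].
  have WW : W *m W = - (delta_mx a a + delta_mx b b).
    rewrite /W !(mulmxBl, mulmxBr) !mm !eqxx (negPf ab) (negPf ba).
    by rewrite !(add0r, subr0, sub0r) opprD.
  have WWW : W *m W *m W = - W.
    rewrite WW mulNmx mulmxDl /W !mulmxBr !mm !eqxx (negPf ab) (negPf ba).
    by rewrite !(add0r, subr0, sub0r).
  rewrite -!scalemxAl -!scalemxAr -!scalemxAl WWW -[- W]scaleN1r !scalerA.
  by congr (_ *: _); rewrite mulCii; ring.
have -> : delta_mx a b = 2^-1 *: H1 + (- ('i%C * 2^-1)) *: ('i%C *: W).
  have e2 : (2^-1 : R[i]) + 2^-1 = 1 by field.
  rewrite scalerA -mulNr mulrAC mulNr mulCii opprK mul1r -scalerDr /H1 /W.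
  by rewrite addrACA subrr addr0 scalerDr -scalerDl e2 scale1r.
split; first by apply: real_part_ruleD; exact: real_part_ruleZ.
by apply: leibniz_ruleD; exact: leibniz_ruleZ.
Qed.

(** Apply the rule for [K] in direction [[Z, L]] and the rule for [L] in direction [[Z, K]], and
    subtract. The [del2] terms cancel by symmetry, and the Jacobi identity combines the remaining
    directions. *)
Lemma del_commutator_lie Z K L : O Z -> leibniz_rule K -> leibniz_rule L ->
  del_commutator Z (L *m K - K *m L) =
  commutator (del_commutator Z L) K - commutator (del_commutator Z K) L.
Proof.
move=> OZ hK hL; rewrite /del_commutator.
have a := hK Z (commutator Z L) OZ; have b := hL Z (commutator Z K) OZ.
refine (etrans _ (congr2 (fun x y : tensmx A n => x - y) a b)).
have s := del2_sym hN oO ph (commutator Z L) (commutator Z K) OZ.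
have dB X Y : del f Z (X - Y) = del f Z X - del f Z Y.
  by rewrite -scaleN1r (delD hN oO ph X (-1 *: Y) OZ) (delZ hN oO ph (-1) Y OZ) scaleN1r.
rewrite -commutator_jacobi dB.
have cancel (p q x y : tensmx A n) : q = p -> x - y = p + x - (q + y).
  by move=> ->; rewrite opprD addrACA subrr add0r.
exact (cancel _ _ _ _ s).
Qed.

End InnerDerivations.

(** * Lie derivations evaluated on matrix units *)

Section MatrixUnits.
Context {R : realType} {E : lmodType R[i]} {n : nat}.

Lemma commutator_delta (X : tensmx E n) a b i j :
  commutator X (delta_mx a b) i j =
  (if j == b then X i a else 0) - (if i == a then X b j else 0).
Proof. by rewrite /commutator !mxE -ractmx_delta -lactmx_delta !mxE. Qed.

Variable d : 'M[R[i]]_n -> tensmx E n.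
Hypotheses (dB : forall K L, d (K - L) = d K - d L)
  (lie : forall a b c e : 'I_n,
     d (delta_mx a b *m delta_mx c e - delta_mx c e *m delta_mx a b) =
     commutator (d (delta_mx a b)) (delta_mx c e)
     - commutator (d (delta_mx c e)) (delta_mx a b)).

Let lie_entry a b c e i j :
  (d (delta_mx a b *m delta_mx c e) - d (delta_mx c e *m delta_mx a b)) i j =
    (if j == e then d (delta_mx a b) i c else 0)
    - (if i == c then d (delta_mx a b) e j else 0)
    - ((if j == b then d (delta_mx c e) i a else 0)
       - (if i == a then d (delta_mx c e) b j else 0)).
Proof. by rewrite -dB lie mxE commutator_delta mxE commutator_delta. Qed.

Let d0 : d 0 = 0.
Proof. by have := dB 0 0; rewrite !subrr. Qed.

Let entryB (X Y : tensmx E n) i j : (X - Y) i j = X i j - Y i j.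
Proof. by rewrite !mxE. Qed.

Let mm (a b c e : 'I_n) : delta_mx a b *m delta_mx c e =
  if b == c then delta_mx a e else 0 :> 'M[R[i]]_n.
Proof. by rewrite mul_delta_mx_cond; case: (b == c). Qed.

(** For [d = [F, .]] both sides are [F_oo - F_ij] if [i = j], and [- F_ij] otherwise; the proof
    obtains the equality from brackets of matrix units alone. *)
Lemma lie_matrix_units (o i j : 'I_n) : i != o -> j != o ->
  d (delta_mx o i) o j = - d (delta_mx j o) i o.
Proof.
move=> io jo; have oi : o != i by rewrite eq_sym.
have oj : o != j by rewrite eq_sym.
apply/eqP; rewrite -addr_eq0; apply/eqP.
have [e|ij] := eqVneq i j; last first.
  have ji : j != i by rewrite eq_sym.
  (* For distinct [i] and [j] the bracket of [E_oi] and [E_jo] is [- E_ji], so the sum in question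
     is minus the [(o, o)] entry of [d (E_ji)]. That entry vanishes because [E_ji] is the bracket of
     [E_jj] and [E_ji], neither of which touches [o]. *)
  have h1 := lie_entry o i j o o o.
  have h2 := lie_entry j j j i o o.
  rewrite !mm !eqxx (negPf ij) (negPf oi) (negPf oj) d0 in h1.
  rewrite !mm !eqxx (negPf ij) (negPf oi) (negPf oj) d0 in h2.
  move: h1; rewrite !entryB !mxE !(subr0, sub0r, opprK) => <-.
  by move: h2; rewrite !entryB !mxE !(subr0, sub0r, opprK) => ->; rewrite oppr0.
rewrite -e in jo oj *; clear e j.
(* The bracket of [E_oi] and [E_io] is [E_oo - E_ii]: the sum in question is the [(o, o)] entry of
   its image and minus the [(i, i)] entry. The two [t] identities show these diagonal entries equal,
   so the sum is its own opposite. *)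
have s_oo := lie_entry o i i o o o.
have s_ii := lie_entry o i i o i i.
have t_o := lie_entry o o o i o i.
have t_i := lie_entry i i i o i o.
rewrite !mm !eqxx ?(negPf io) ?(negPf oi) !entryB ?d0 ?mxE ?subr0 ?sub0r ?opprK in s_oo.
rewrite !mm !eqxx ?(negPf io) ?(negPf oi) !entryB ?d0 ?mxE ?subr0 ?sub0r ?opprK in s_ii.
rewrite !mm !eqxx ?(negPf io) ?(negPf oi) !entryB ?d0 ?mxE ?subr0 ?sub0r ?opprK in t_o.
rewrite !mm !eqxx ?(negPf io) ?(negPf oi) !entryB ?d0 ?mxE ?subr0 ?sub0r ?opprK in t_i.
have cancel (x a b : E) : x = a - b + x -> a = b.
  by move=> h; apply/eqP; rewrite -subr_eq0 -[_ - _](addrK x) -h subrr.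
move: s_oo; rewrite (cancel _ _ _ t_o) -(cancel _ _ _ t_i) s_ii -opprD => /esym/eqP.
rewrite -addr_eq0 -mulr2n -scaler_nat scaler_eq0 pnatr_eq0 /= => /eqP.
exact.
Qed.

End MatrixUnits.

(** * Free functions *)

Section Transport.
Context {R : realType} {E1 E2 F1 F2 : topologicalLmodType R[i]}.
Context {N1 : F1 -> R} {N2 : F2 -> R}.
Hypotheses (hN1 : compatible_norm N1) (hN2 : compatible_norm N2).
Variables (O : set E1) (oO : open O) (f : E1 -> F1) (g : E2 -> F2).
Variables (T : E1 -> E2) (z : E2) (L : F1 -> F2) (c : F2).
Hypotheses (TD : forall a b, T (a + b) = T a + T b)
  (TZ : forall k a, T (k *: a) = k *: T a)
  (cL : continuous L) (LD : forall a b, L (a + b) = L a + L b)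
  (LZ : forall k a, L (k *: a) = k *: L a)
  (fg : forall y, O y -> g (T y + z) = L (f y) + c).

Lemma has_rderive_transport y v l : O y ->
  has_rderive f y v l -> has_rderive g (T y + z) (T v) (L l).
Proof.
move=> Oy h.
have Lh : has_rderive (fun y => L (f y)) y v (L l) by exact: has_rderive_linear h.
apply/(has_rderiveP hN2) => e e0.
have [d d0 hd] := (has_rderiveP hN2 _ _ _ _).1 Lh e e0.
have [d' d'0 hd'] := (near_nbhs0P _).1 (near_line v oO Oy).
exists (Num.min d d'); first by rewrite lt_min d0.
move=> t; rewrite lt_min => /andP[td td'].
rewrite (addrAC (T y) z) -TZ -TD !fg //; last exact: hd'.
have -> : L (f (y + t%:C *: v)) + c - (L (f y) + c) = L (f (y + t%:C *: v)) - L (f y).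
  by rewrite opprD addrACA subrr addr0.
exact: hd.
Qed.

(** One chain rule for affine changes on both sides, used for permutations of indices, for unitary
    conjugation, and for adding a fixed summand [Y], where [z] and [c] are [Y] and [u Y] placed in
    the second block. *)
Lemma del_transport y v : C1_on O f -> O y -> del g (T y + z) (T v) = L (del f y v).
Proof.
move=> fC1 Oy.
have h w := has_rderive_transport Oy (rderivableP hN1 (fC1 y w Oy).1).
rewrite /del (has_rderiveE hN2 (h v)) -TZ (has_rderiveE hN2 (h ('i%C *: v))).
by rewrite LD -[in RHS]scaleNr LZ scaleNr.
Qed.

End Transport.

Section Reindexing.
Context {R : realType}.

(** The sizes are kept apart because sums such as [p + q + r] and [p + r + q] are equal without
    being convertible. *)
Definition reindex_mx {E : Type} {N M} (s : 'I_N -> 'I_M) (X : tensmx E M) :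
  tensmx E N := mxsub s s X.

Lemma reindex_mxD {E : lmodType R[i]} {N M} (s : 'I_N -> 'I_M) (X Y : tensmx E M) :
  reindex_mx s (X + Y) = reindex_mx s X + reindex_mx s Y.
Proof. by apply/matrixP => i j; rewrite !mxE. Qed.

Lemma reindex_mxZ {E : lmodType R[i]} {N M} (s : 'I_N -> 'I_M) (c : R[i]) (X : tensmx E M) :
  reindex_mx s (c *: X) = c *: reindex_mx s X.
Proof. by apply/matrixP => i j; rewrite tensmx_scaleE !mxE. Qed.

Lemma reindex_mx_continuous {E : topologicalLmodType R[i]} {N M} (s : 'I_N -> 'I_M) :
  continuous (fun X : tensmx E M => reindex_mx s X).
Proof.
move=> X; apply: (tensmx_cvg (FG := nbhs_filter X)) => i j.
have -> : (fun x : tensmx E M => reindex_mx s x i j) = fun x => x (s i) (s j).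
  by apply/funext => x; rewrite mxE.
rewrite mxE; exact: (tensmx_entry_cvg (FG := nbhs_filter X) (f := id)).
Qed.

Lemma reindex_commutator {E : lmodType R[i]} {N M} (s : 'I_N -> 'I_M) (X : tensmx E M)
    (a b : 'I_N) : injective s ->
  reindex_mx s (commutator X (delta_mx (s a) (s b))) =
  commutator (reindex_mx s X) (delta_mx a b).
Proof.
move=> sI; apply/matrixP => i j; rewrite mxE !commutator_delta !(inj_eq sI).
by rewrite ![reindex_mx s X _ _]mxE.
Qed.

Lemma dsumE {E : lmodType R[i]} {p q} (X : tensmx E p) (Y : tensmx E q) :
  (forall i j, dsum X Y (lshift q i) (lshift q j) = X i j) *
  (forall i j, dsum X Y (lshift q i) (rshift p j) = 0) *
  (forall i j, dsum X Y (rshift p i) (lshift q j) = 0) *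
  (forall i j, dsum X Y (rshift p i) (rshift p j) = Y i j).
Proof.
rewrite /dsum; split; [split; [split|]|] => i j.
- exact: block_mxEul.
- by rewrite block_mxEur mxE.
- by rewrite block_mxEdl mxE.
- exact: block_mxEdr.
Qed.

Lemma tensmx_block_eq {E : lmodType R[i]} {p q} (X Y : tensmx E (p + q)) :
  (forall i j, X (lshift q i) (lshift q j) = Y (lshift q i) (lshift q j)) ->
  (forall i j, X (lshift q i) (rshift p j) = Y (lshift q i) (rshift p j)) ->
  (forall i j, X (rshift p i) (lshift q j) = Y (rshift p i) (lshift q j)) ->
  (forall i j, X (rshift p i) (rshift p j) = Y (rshift p i) (rshift p j)) -> X = Y.
Proof.
move=> h1 h2 h3 h4; apply/matrixP => i j.
by case: (split_ordP i) => k ->; case: (split_ordP j) => l ->.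
Qed.

Lemma tensmx_addE {E : lmodType R[i]} {n} (X Y : tensmx E n) i j :
  (X + Y) i j = X i j + Y i j.
Proof. by rewrite mxE. Qed.

Lemma tensmx_0E {E : lmodType R[i]} {n} (i j : 'I_n) : (0 : tensmx E n) i j = 0.
Proof. by rewrite mxE. Qed.

Lemma dsumD {E : lmodType R[i]} {p q} (X X' : tensmx E p) (Y Y' : tensmx E q) :
  dsum (X + X') (Y + Y') = dsum X Y + dsum X' Y'.
Proof. by apply: tensmx_block_eq => i j; rewrite tensmx_addE !dsumE ?tensmx_addE ?addr0. Qed.

Lemma dsumZ {E : lmodType R[i]} {p q} (c : R[i]) (X : tensmx E p) (Y : tensmx E q) :
  dsum (c *: X) (c *: Y) = c *: dsum X Y.
Proof.
by apply: tensmx_block_eq => i j; rewrite [RHS]tensmx_scaleE !dsumE ?tensmx_scaleE ?scaler0.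
Qed.

Lemma dsum_continuous {E : topologicalLmodType R[i]} {p q} (Y : tensmx E q) :
  continuous (fun X : tensmx E p => dsum X Y).
Proof.
move=> X; apply: (tensmx_cvg (FG := nbhs_filter X)) => i j.
case: (split_ordP i) => k ->; case: (split_ordP j) => l ->.
- under eq_fun do rewrite dsumE.
  rewrite dsumE; exact: (tensmx_entry_cvg (FG := nbhs_filter X) (f := id)).
- under eq_fun do rewrite dsumE.
  by rewrite dsumE; exact: cvg_cst.
- under eq_fun do rewrite dsumE.
  by rewrite dsumE; exact: cvg_cst.
- under eq_fun do rewrite dsumE.
  by rewrite dsumE; exact: cvg_cst.
Qed.

Lemma dsum_commutator {E : lmodType R[i]} {p q} (X : tensmx E p) (Y : tensmx E q)
    (a b : 'I_p) :
  commutator (dsum X Y) (delta_mx (lshift q a) (lshift q b)) =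
  dsum (commutator X (delta_mx a b)) 0.
Proof.
by apply: tensmx_block_eq => i j; rewrite commutator_delta !dsumE
  ?commutator_delta ?tensmx_0E ?(inj_eq lshift_inj) ?eq_lrshift ?eq_rlshift
  ?if_same ?subr0 ?sub0r ?oppr0.
Qed.

End Reindexing.

Section FreeDerivatives.
Context {R : realType} {E : topologicalLmodType R[i]} {A : cstarAlgType R}.
Local Open Scope sesquilinear_scope.
Let hN n := @mxnorm_compatible R A n.

Lemma unitary_conjD {V : lmodType R[i]} {n} (U : 'M[R[i]]_n) (X Y : tensmx V n) :
  unitary_conj U (X + Y) = unitary_conj U X + unitary_conj U Y.
Proof. by rewrite /unitary_conj lactmxDr ractmxDl. Qed.

Lemma unitary_conjZ {V : lmodType R[i]} {n} (U : 'M[R[i]]_n) c (X : tensmx V n) :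
  unitary_conj U (c *: X) = c *: unitary_conj U X.
Proof. by rewrite /unitary_conj lactmxZr ractmxZl. Qed.

Lemma unitary_conj_continuous {V : topologicalLmodType R[i]} {n} (U : 'M[R[i]]_n) :
  continuous (fun X : tensmx V n => unitary_conj U X).
Proof.
move=> X; exact (@continuous_comp _ _ _ (fun X : tensmx V n => lactmx (U^t*) X)
  (fun X : tensmx V n => ractmx X U) X (@lactmx_continuous _ _ _ _ X)
  (@ractmx_continuous _ _ _ _ _)).
Qed.

Lemma unitary_conj_commutator {V : lmodType R[i]} {n} (U : 'M[R[i]]_n) (X : tensmx V n) K :
  U \is unitarymx ->
  commutator (unitary_conj U X) K = unitary_conj U (commutator X (U *m K *m U^t*)).
Proof.
move=> Uu; have U1 : U *m U^t* = 1%:M by apply/unitarymxP.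
have U2 : U^t* *m U = 1%:M by exact: mulmx1C U1.
rewrite /commutator -[- lactmx (_ *m _) _]scaleN1r unitary_conjD unitary_conjZ scaleN1r.
rewrite /unitary_conj.
congr (_ - _).
  by rewrite !lractmxC -!ractmxM -!mulmxA U2 mulmx1.
by rewrite -lractmxC -!lactmxM !mulmxA U2 mul1mx -lractmxC lractmxC.
Qed.

Variables (D : forall n, set (tensmx E n)) (S : set A)
  (u : forall n, tensmx E n -> tensmx A n).
Hypotheses (fD : free_set D) (oD : free_open D) (fu : real_free_function D S u)
  (phu : free_pluriharmonic D u).

(** A bijection forces equal sizes, and reindexing is then conjugation by a permutation matrix,
    which is unitary. *)
Lemma free_reindex {N M} (s : 'I_N -> 'I_M) (X : tensmx E M) :
  bijective s -> (0 < M)%N -> D X ->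
  D (reindex_mx s X) /\ u (reindex_mx s X) = reindex_mx s (u X).
Proof.
move=> sb M0 DX; have e : N = M by have := bij_eq_card sb; rewrite !card_ord.
subst N; have sI := bij_inj sb.
pose U : 'M[R[i]]_M := \matrix_(k, j) (k == s j)%:R.
have Uu : U \is unitarymx.
  apply/unitarymxP/mulmx1C/matrixP => i j; rewrite !mxE (bigD1 (s i)) //= !mxE eqxx.
  rewrite big1 => [|k ki]; first by rewrite rmorph1 mul1r addr0 (inj_eq sI).
  by rewrite !mxE (negPf ki) rmorph0 mul0r.
have UE (V : lmodType R[i]) (Y : tensmx V M) : unitary_conj U Y = reindex_mx s Y.
  apply/matrixP => i j; rewrite !mxE (bigD1 (s j)) //= mxE eqxx scale1r.
  rewrite [X in _ + X]big1 => [|k kj]; last by rewrite mxE (negPf kj) scale0r.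
  rewrite addr0 mxE (bigD1 (s i)) //= !mxE eqxx rmorph1 scale1r.
  rewrite big1 ?addr0 // => k ki; by rewrite !mxE (negPf ki) rmorph0 scale0r.
rewrite -!UE; split; first exact: fD.2.
by case: fu => _ _ h; exact: h.
Qed.

Lemma free_C1 {n} : (0 < n)%N -> C1_on (@D n) (@u n).
Proof. by move=> /phu[_ [h _]]; exact: C2_C1. Qed.

Lemma del_free_reindex {N M} (s : 'I_N -> 'I_M) (Z H : tensmx E M) :
  bijective s -> (0 < M)%N -> D Z ->
  del (@u N) (reindex_mx s Z) (reindex_mx s H) = reindex_mx s (del (@u M) Z H).
Proof.
move=> sb M0 DZ; have fg (y : tensmx E M) : D y ->
    u (reindex_mx s y + 0) = reindex_mx s (u y) + 0.
  by move=> Dy; rewrite !addr0 (free_reindex sb M0 Dy).2.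
have := del_transport (hN M) (hN N) (oD M0) (reindex_mxD s) (reindex_mxZ s)
  (@reindex_mx_continuous _ _ _ _ s) (reindex_mxD s) (reindex_mxZ s) fg H (free_C1 M0) DZ.
by rewrite addr0.
Qed.

Lemma del_free_unitary {n} (U : 'M[R[i]]_n) (Z H : tensmx E n) :
  U \is unitarymx -> (0 < n)%N -> D Z ->
  del (@u n) (unitary_conj U Z) (unitary_conj U H) = unitary_conj U (del (@u n) Z H).
Proof.
move=> Uu n0 DZ; have fg (y : tensmx E n) : D y ->
    u (unitary_conj U y + 0) = unitary_conj U (u y) + 0.
  by move=> Dy; rewrite !addr0; case: fu => _ _; apply.
have := del_transport (hN n) (hN n) (oD n0) (unitary_conjD U) (unitary_conjZ U)
  (@unitary_conj_continuous _ _ U) (unitary_conjD U) (unitary_conjZ U) fg H (free_C1 n0) DZ.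
by rewrite addr0.
Qed.

Lemma del_free_dsum {p q} (X H : tensmx E p) (Y : tensmx E q) :
  (0 < p)%N -> (0 < q)%N -> D X -> D Y ->
  del (@u (p + q)) (dsum X Y) (dsum H 0) = dsum (del (@u p) X H) 0.
Proof.
move=> p0 q0 DX DY.
have TD (V : lmodType R[i]) (a b : tensmx V p) :
    dsum (a + b) (0 : tensmx V q) = dsum a 0 + dsum b 0 by rewrite -dsumD addr0.
have TZ (V : lmodType R[i]) k (a : tensmx V p) :
    dsum (k *: a) (0 : tensmx V q) = k *: dsum a 0 by rewrite -dsumZ scaler0.
have fg (y : tensmx E p) : D y ->
    u (dsum y 0 + dsum 0 Y) = dsum (u y) 0 + dsum 0 (u Y).
  move=> Dy; rewrite -!dsumD !addr0 !add0r; case: fu => _ h _; exact: h.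
have := del_transport (hN p) (hN (p + q)) (oD p0) (TD E) (TZ E)
  (@dsum_continuous _ _ _ _ _) (TD A) (TZ A) fg H (free_C1 p0) DX.
by rewrite -dsumD addr0 add0r.
Qed.

(** A matrix unit supported in the block of [X] commutes with the summand [Y], so only [X] moves and
    the other blocks of the derivative vanish. *)
Lemma del_commutator_block {N p q} (s : 'I_(p + q) -> 'I_N) (Z : tensmx E N)
    (X : tensmx E p) (Y : tensmx E q) (a b : 'I_p) :
  bijective s -> (0 < p)%N -> (0 < q)%N -> D Z -> D X -> D Y ->
  reindex_mx s Z = dsum X Y ->
  reindex_mx s (del_commutator (@u N) Z (delta_mx (s (lshift q a)) (s (lshift q b)))) =
  dsum (del_commutator (@u p) X (delta_mx a b)) 0.
Proof.
move=> sb p0 q0 DZ DX DY ZE; have N0 : (0 < N)%N.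
  by exact: leq_ltn_trans (leq0n _) (ltn_ord (s (lshift q a))).
rewrite /del_commutator -del_free_reindex // reindex_commutator; last exact: bij_inj.
by rewrite ZE dsum_commutator del_free_dsum.
Qed.

End FreeDerivatives.

(** * Permutations of three diagonal blocks *)

Section BlockSwaps.
Context {R : realType} {E : lmodType R[i]}.

(** The conjugate at [X] plus [Y] is computed with [X0] in third place, while those at [X] and at
    [Y] need [X0] in the adjacent place; the two swaps move the blocks accordingly. *)
Definition swap_last p q r (x : 'I_(p + q + r)) : 'I_(p + r + q) :=
  match fintype.split x with
  | inl y => match fintype.split y with
             | inl i => lshift q (lshift r i)
             | inr k => rshift (p + r) k
             end
  | inr j => lshift q (rshift p j)
  end.

Definition swap_first p q r (x : 'I_(p + q + r)) : 'I_(q + p + r) :=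
  match fintype.split x with
  | inl y => match fintype.split y with
             | inl i => lshift r (rshift q i)
             | inr k => lshift r (lshift p k)
             end
  | inr j => rshift (q + p) j
  end.

Lemma split_lshift m n (i : 'I_m) : fintype.split (lshift n i) = inl i.
Proof. exact: (unsplitK (inl i)). Qed.

Lemma split_rshift m n (i : 'I_n) : fintype.split (rshift m i) = inr i.
Proof. exact: (unsplitK (inr i)). Qed.

Lemma swap_lastE p q r :
  (forall i : 'I_p, swap_last (lshift r (lshift q i)) = lshift q (lshift r i)) *
  (forall k : 'I_q, swap_last (lshift r (rshift p k)) = rshift (p + r) k) *
  (forall j : 'I_r, swap_last (rshift (p + q) j) = lshift q (rshift p j)).
Proof. by rewrite /swap_last; split; [split|] => i; rewrite ?(split_lshift, split_rshift). Qed.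

Lemma swap_firstE p q r :
  (forall i : 'I_p, swap_first (lshift r (lshift q i)) = lshift r (rshift q i)) *
  (forall k : 'I_q, swap_first (lshift r (rshift p k)) = lshift r (lshift p k)) *
  (forall j : 'I_r, swap_first (rshift (p + q) j) = rshift (q + p) j).
Proof. by rewrite /swap_first; split; [split|] => i; rewrite ?(split_lshift, split_rshift). Qed.

Lemma block3_ind p q r (P : 'I_(p + q + r) -> Prop) :
  (forall i, P (lshift r (lshift q i))) -> (forall k, P (lshift r (rshift p k))) ->
  (forall j, P (rshift (p + q) j)) -> forall x, P x.
Proof.
move=> h1 h2 h3 x; case: (split_ordP x) => y -> //.
by case: (split_ordP y) => z ->.
Qed.

Lemma swap_last_bij p q r : bijective (@swap_last p q r).
Proof.
by exists (@swap_last p r q); apply: block3_ind => i; rewrite !swap_lastE.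
Qed.

Lemma swap_first_bij p q r : bijective (@swap_first p q r).
Proof.
by exists (@swap_first q p r); apply: block3_ind => i; rewrite !swap_firstE.
Qed.

Lemma reindex_swap_last p q r (X : tensmx E p) (Y : tensmx E q) (Z : tensmx E r) :
  reindex_mx (@swap_last p r q) (dsum (dsum X Y) Z) = dsum (dsum X Z) Y.
Proof.
apply/matrixP; apply: block3_ind => i; apply: block3_ind => j;
  by rewrite mxE !swap_lastE !dsumE.
Qed.

Lemma reindex_swap_first p q r (X : tensmx E p) (Y : tensmx E q) (Z : tensmx E r) :
  reindex_mx (@swap_first q p r) (dsum (dsum X Y) Z) = dsum (dsum Y X) Z.
Proof.
apply/matrixP; apply: block3_ind => i; apply: block3_ind => j;
  by rewrite mxE !swap_firstE !dsumE.
Qed.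

End BlockSwaps.

Section ClosureSubspace.
Context {R : realType} {A : cstarAlgType R}.

Lemma closure_cvg {T : topologicalType} {I : Type} (G : set_system I) {FG : ProperFilter G}
    (S : set T) (f : I -> T) (l : T) :
  (\forall x \near G, S (f x)) -> f @ G --> l -> closure S l.
Proof.
move=> hS fl B nB; have [x [Sx Bx]] := filter_ex (filterI hS (fl B nB)).
by exists (f x).
Qed.

Lemma closure_subspace (S : set A) : subspace_of S -> subspace_of (closure S).
Proof.
move=> [S0 SD SZ]; split=> [|a b ca cb B nB|c a ca B nB]; first exact: subset_closure.
  have [[U V] /= [nU nV] UV] := @add_continuous A (a, b) B nB.
  have [x [Sx Ux]] := ca U nU; have [y [Sy Vy]] := cb V nV.
  by exists (x + y); split; [exact: SD|exact: (UV (x, y))].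
have nU : nbhs a [set x | B (c *: x)] by exact: (@scaler_continuous _ A c a B nB).
by have [x [Sx Ux]] := ca _ nU; exists (c *: x); split => //; exact: SZ.
Qed.

End ClosureSubspace.

(** * The pluriharmonic conjugate *)

Section Conjugate.
Context {R : realType} {E : topologicalLmodType R[i]} {A : cstarAlgType R}.
Local Open Scope sesquilinear_scope.
Let hN n := @mxnorm_compatible R A n.
Variables (D : forall n, set (tensmx E n)) (S : set A)
  (u : forall n, tensmx E n -> tensmx A n).
Hypotheses (sS : subspace_of S) (fD : free_set D) (oD : free_open D)
  (fu : real_free_function D S u) (phu : free_pluriharmonic D u).
Variables (m : nat) (X0 : tensmx E m.+1) (DX0 : D X0).

Local Notation base n := (rshift n (ord0 : 'I_m.+1)).

(* If u = Re f with f free, the (j, i) entry is f_ji - (j = i) f(X0)_oo, where o is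
   the first index of X0. *)
Definition conjugate_part {n} (X : tensmx E n) : tensmx A n :=
  \matrix_(j, i) del_commutator (@u (n + m.+1)) (dsum X X0)
    (delta_mx (lshift m.+1 i) (base n)) (lshift m.+1 j) (base n).

Definition scalar_tensmx {n} (a : A) : tensmx A n :=
  \matrix_(j, i) (if j == i then a else 0).

Definition conjugate {n} (X : tensmx E n) : tensmx A n :=
  conjugate_part X + scalar_tensmx (u X0 ord0 ord0).

Lemma conjugate_partE {n} (X : tensmx E n) j i : conjugate_part X j i =
  del_commutator (@u (n + m.+1)) (dsum X X0)
    (delta_mx (lshift m.+1 i) (base n)) (lshift m.+1 j) (base n).
Proof. by rewrite [LHS]mxE. Qed.

Lemma scalar_tensmxE {n} (a : A) (j i : 'I_n) :
  scalar_tensmx a j i = if j == i then a else 0.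
Proof. by rewrite [LHS]mxE. Qed.

Lemma conjugateE {n} (X : tensmx E n) j i : conjugate X j i =
  del_commutator (@u (n + m.+1)) (dsum X X0)
    (delta_mx (lshift m.+1 i) (base n)) (lshift m.+1 j) (base n)
  + (if j == i then u X0 ord0 ord0 else 0).
Proof. by rewrite tensmx_addE conjugate_partE scalar_tensmxE. Qed.

Lemma dsum_base {n} (X : tensmx E n) : (0 < n)%N -> D X -> D (dsum X X0).
Proof. by move=> n0 DX; apply: fD.1. Qed.

Lemma u_dsum {p q} (X : tensmx E p) (Y : tensmx E q) :
  (0 < p)%N -> (0 < q)%N -> D X -> D Y -> u (dsum X Y) = dsum (u X) (u Y).
Proof. by case: fu => _ h _; exact: h. Qed.

Lemma u_selfadjoint {n} (X : tensmx E n) : (0 < n)%N -> D X -> selfadjoint (u X).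
Proof. by move=> /phu[h _]; exact: h. Qed.

Lemma u_unitary {n} U (X : tensmx E n) : (0 < n)%N -> U \is unitarymx -> D X ->
  u (unitary_conj U X) = unitary_conj U (u X).
Proof. by case: fu => _ _ h; exact: h. Qed.

Let ph {n} (n0 : (0 < n)%N) : pluriharmonic_on (D (n := n)) (u (n := n)) := (phu n0).2.

(** The adjoint rule at [E_io], read at position [(j, o)], gives twice the [(j, i)] entry of [u X],
    up to the constant on the diagonal. Its adjoint term is turned into the adjoint of the [(i, j)]
    entry of the conjugate by [lie_matrix_units]. *)
Lemma conjugate_Re {n} (X : tensmx E n) : (0 < n)%N -> D X -> u X = Remx (conjugate X).
Proof.
move=> n0 DX; have DZ := dsum_base n0 DX; have N0 : (0 < n + m.+1)%N by rewrite addnS.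
have ru K := rules_delta (oD N0) (ph N0) (fun X => u_selfadjoint N0 (X := X))
  (fun V X => u_unitary (U := V) (X := X) N0) K.
set o := base n; set Z := dsum X X0 in DZ.
have lo i : lshift m.+1 i != o by rewrite eq_lrshift.
have [d dE] : exists d, d = del_commutator (@u (n + m.+1)) Z by eexists.
have dB K L : d (K - L) = d K - d L.
  rewrite -scaleN1r dE (del_commutatorD (oD N0) (ph N0)) //.
  by rewrite (del_commutatorZ (oD N0) (ph N0)) // scaleN1r.
have lie a b c e : d (delta_mx a b *m delta_mx c e - delta_mx c e *m delta_mx a b) =
    commutator (d (delta_mx a b)) (delta_mx c e)
    - commutator (d (delta_mx c e)) (delta_mx a b).
  rewrite dE; exact: (del_commutator_lie (oD N0) (ph N0) DZ (ru c e).2 (ru a b).2).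
have u0 : adj (u X0 ord0 ord0) = u X0 ord0 ord0.
  have := u_selfadjoint (ltn0Sn m) DX0.
  by move=> /matrixP/(_ ord0 ord0); rewrite mxE.
have key : 2 *: u X = conjugate X + adjmx (conjugate X).
  apply/matrixP => j i; rewrite tensmx_scaleE tensmx_addE [adjmx _ j i]mxE !conjugateE -/o -/Z -dE.
  (* The diagonal constant appears once from [conjugate X] and once from its adjoint, matching the
     doubled corner entry on the right of the rule. *)
  have /matrixP/(_ (lshift m.+1 j) o) := (ru (lshift m.+1 i) o).1 Z DZ.
  have := lie_matrix_units dB lie (lo i) (lo j).
  rewrite delta_mx_adj tensmx_scaleE commutator_delta eqxx -dE -/o -/Z => hl.
  rewrite tensmx_addE [(- adjmx _) _ _]mxE [adjmx _ _ _]mxE hl.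
  rewrite eq_lshift (u_dsum n0 (ltn0Sn m) DX DX0) !dsumE adjD.
  have -> : adj (if i == j then u X0 ord0 ord0 else 0) =
      if j == i then u X0 ord0 ord0 else 0.
    by rewrite eq_sym; case: eqP => _; rewrite ?u0 ?adj0.
  move: (if _ then _ else _) (d (delta_mx (lshift m.+1 i) o) (lshift m.+1 j) o)
    (d (delta_mx (lshift m.+1 j) o) (lshift m.+1 i) o) => w a b.
  have -> : adj (- b) = - adj b.
    by apply/eqP; rewrite -addr_eq0 -adjD addNr adj0.
  rewrite opprK scalerBr => /eqP; rewrite eq_sym subr_eq => /eqP ->.
  by module R[i].
by rewrite /Remx -key scalerA mulVf ?pnatr_eq0 // scale1r.
Qed.



(** Difference quotients of [u] stay in the subspace [S] entrywise; passing to the limit is what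
    replaces [S] by its closure. *)
Lemma rderive_closure {n} (X H : tensmx E n) i j : (0 < n)%N -> D X ->
  closure S (rderive (@u n) X H i j).
Proof.
move=> n0 DX; have [S0 SD SZ] := sS.
have h := rderivableP (hN n) (free_C1 phu n0 H DX).1.
apply: (closure_cvg (f := fun t => rquot (@u n) X H t i j) _
  (tensmx_entry_cvg (i := i) (j := j) h)).
have [d d0 hd] := (near_nbhs0P _).1 (near_line H (oD n0) DX).
apply/near_dnbhs0P; exists d => // t _ /hd DXt; rewrite /rquot tensmx_scaleE.
apply: (SZ); rewrite tensmx_addE -scaleN1r tensmx_scaleE.
have hS Y : D Y -> S (u Y i j) by move=> DY; case: fu => h1 _ _; exact: h1.
by apply: SD; [exact: hS|apply: SZ; exact: hS].
Qed.

Lemma conjugate_closure {n} (X : tensmx E n) : (0 < n)%N -> D X ->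
  matrices_over (closure S) (conjugate X).
Proof.
move=> n0 DX j i; have [c0 cD cZ] := closure_subspace sS.
have DZ := dsum_base n0 DX; have N0 : (0 < n + m.+1)%N by rewrite addnS.
rewrite conjugateE; apply: (cD).
  rewrite /del_commutator /del tensmx_addE -scaleNr tensmx_scaleE.
  by apply: (cD); [|apply: (cZ)]; exact: rderive_closure.
case: eqP => _ //; apply: subset_closure.
by case: fu => h _ _; exact: h.
Qed.

(** A column index in [X] involves only the blocks of [X] and [X0], and one in [Y] only those of [Y]
    and [X0]. The permutations [s] and [t] bring the relevant pair to the front, and the third
    summand drops out. *)
Lemma conjugate_dsum {p q} (X : tensmx E p) (Y : tensmx E q) :
  (0 < p)%N -> (0 < q)%N -> D X -> D Y ->
  conjugate (dsum X Y) = dsum (conjugate X) (conjugate Y).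
Proof.
move=> p0 q0 DX DY.
have DXY : D (dsum X Y) by apply: fD.1.
have pq0 : (0 < p + q)%N by rewrite ltn_addr.
have N1 : (0 < p + m.+1)%N by rewrite addnS.
have N2 : (0 < q + m.+1)%N by rewrite addnS.
have DZ := dsum_base pq0 DXY; have DX1 := dsum_base p0 DX; have DY1 := dsum_base q0 DY.
pose s : 'I_(p + m.+1 + q) -> 'I_(p + q + m.+1) := @swap_last p m.+1 q.
pose t : 'I_(q + m.+1 + p) -> 'I_(p + q + m.+1) :=
  fun x => swap_first (@swap_last q m.+1 p x).
have sb : bijective s by exact: swap_last_bij.
have tb : bijective t by exact: (bij_comp (@swap_first_bij q p m.+1) (@swap_last_bij q m.+1 p)).
have sE : reindex_mx s (dsum (dsum X Y) X0) = dsum (dsum X X0) Y.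
  exact: reindex_swap_last.
have tE : reindex_mx t (dsum (dsum X Y) X0) = dsum (dsum Y X0) X.
  rewrite -(reindex_swap_last Y X X0) -(reindex_swap_first X Y X0).
  by apply/matrixP => i j; rewrite !mxE.
have hs a b := del_commutator_block fD oD fu phu a b sb N1 q0 DZ DX1 DY sE.
have ht a b := del_commutator_block fD oD fu phu a b tb N2 p0 DZ DY1 DX tE.
apply: tensmx_block_eq => j i; rewrite conjugateE !dsumE.
- have /matrixP/(_ (lshift q (lshift m.+1 j)) (lshift q (base p))) := hs (lshift m.+1 i) (base p).
  rewrite mxE /s !swap_lastE dsumE => ->.
  by rewrite conjugateE eq_lshift.
(* Here the matrix unit lives in the blocks of [Y] and [X0] while the row lies in [X], so the entry
   is zero. *)
- have /matrixP/(_ (rshift (q + m.+1) j) (lshift p (base q))) := ht (lshift m.+1 i) (base q).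
  rewrite mxE /t !swap_lastE !swap_firstE dsumE => ->.
  by rewrite eq_lrshift addr0.
- have /matrixP/(_ (rshift (p + m.+1) j) (lshift q (base p))) := hs (lshift m.+1 i) (base p).
  rewrite mxE /s !swap_lastE dsumE => ->.
  by rewrite eq_rlshift addr0.
have /matrixP/(_ (lshift p (lshift m.+1 j)) (lshift p (base q))) := ht (lshift m.+1 i) (base q).
rewrite mxE /t !swap_lastE !swap_firstE dsumE => ->.
by rewrite conjugateE eq_rshift.
Qed.

End Conjugate.

(** * Unitary equivariance and analyticity of the conjugate *)

Section ConjugateUnitaryAnalytic.
Context {R : realType} {E : topologicalLmodType R[i]} {A : cstarAlgType R}.
Local Open Scope sesquilinear_scope.
Let hN n := @mxnorm_compatible R A n.
Variables (D : forall n, set (tensmx E n)) (S : set A)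
  (u : forall n, tensmx E n -> tensmx A n).
Hypotheses (sS : subspace_of S) (fD : free_set D) (oD : free_open D)
  (fu : real_free_function D S u) (phu : free_pluriharmonic D u).
Variables (m : nat) (X0 : tensmx E m.+1) (DX0 : D X0).

Local Notation base n := (rshift n (ord0 : 'I_m.+1)).
Local Notation part := (conjugate_part u X0).

Lemma ractmx_scalar n (a : A) (V : 'M[R[i]]_n) i j :
  ractmx (scalar_tensmx a) V i j = V i j *: a.
Proof.
rewrite mxE (bigD1 i) //= scalar_tensmxE eqxx big1 ?addr0 // => k ki.
by rewrite scalar_tensmxE eq_sym (negPf ki) scaler0.
Qed.

Lemma lactmx_scalar n (a : A) (V : 'M[R[i]]_n) i j :
  lactmx V (scalar_tensmx a) i j = V i j *: a.
Proof.
rewrite mxE (bigD1 j) //= scalar_tensmxE eqxx big1 ?addr0 // => k kj.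
by rewrite scalar_tensmxE (negPf kj) scaler0.
Qed.

Lemma unitary_conj_scalar n (a : A) (U : 'M[R[i]]_n) : U \is unitarymx ->
  unitary_conj U (scalar_tensmx a) = scalar_tensmx a.
Proof.
move=> /unitarymxP/mulmx1C UU; rewrite /unitary_conj.
have -> : lactmx (U^t*) (scalar_tensmx a) = ractmx (scalar_tensmx a) (U^t*).
  by apply/matrixP => i j; rewrite lactmx_scalar ractmx_scalar.
by rewrite -ractmxM UU ractmx1.
Qed.

Lemma mulmx_delta_adj n (W : 'M[R[i]]_n) a b x y :
  (W *m delta_mx a b *m W^t*) x y = W x a * Num.conj (W y b).
Proof.
rewrite mxE (bigD1 b) //= big1 => [|k kb].
  rewrite addr0 mxE (bigD1 a) //= big1 => [|k ka].
    by rewrite !mxE !eqxx mulr1 addr0.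
  by rewrite !mxE (negPf ka) mulr0.
by rewrite mxE big1 ?mul0r // => l _; rewrite mxE (negPf kb) andbF mulr0.
Qed.

Lemma del_commutator_sum {n} (Z : tensmx E n) {I : Type} (r : seq I)
    (c : I -> R[i]) (K : I -> 'M[R[i]]_n) : (0 < n)%N -> D Z ->
  del_commutator (@u n) Z (\sum_(k <- r) c k *: K k) =
  \sum_(k <- r) c k *: del_commutator (@u n) Z (K k).
Proof.
move=> n0 DZ; have ph := (phu n0).2.
elim: r => [|k r IH]; last first.
  by rewrite !big_cons (del_commutatorD (oD n0) ph) // (del_commutatorZ (oD n0) ph) // IH.
rewrite !big_nil -(scale0r (0 : 'M[R[i]]_n)) (del_commutatorZ (oD n0) ph) //.
exact: scale0r.
Qed.

(** Extend [U] by the identity to [W], which leaves [X0] fixed. Equivariance of [del] moves [W] onto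
    the matrix unit, whose conjugate is a combination of matrix units with the same column [o], and
    linearity in [K] finishes. *)
Lemma conjugate_part_unitary {n} (U : 'M[R[i]]_n) (X : tensmx E n) :
  (0 < n)%N -> U \is unitarymx -> D X ->
  part (unitary_conj U X) = unitary_conj U (part X).
Proof.
move=> n0 Uu DX; have DZ := dsum_base fD DX0 n0 DX.
have N0 : (0 < n + m.+1)%N by rewrite addnS.
set Z := dsum X X0 in DZ.
pose W : 'M[R[i]]_(n + m.+1) := block_mx U 0 0 1%:M.
have Wll i j : W (lshift m.+1 i) (lshift m.+1 j) = U i j by exact: block_mxEul.
have Wlr i j : W (lshift m.+1 i) (rshift n j) = 0 by rewrite block_mxEur mxE.
have Wrl i j : W (rshift n i) (lshift m.+1 j) = 0 by rewrite block_mxEdl mxE.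
have Wrr i j : W (rshift n i) (rshift n j) = (i == j)%:R by rewrite block_mxEdr mxE.
have Wadj : W^t* = block_mx (U^t*) 0 0 1%:M.
  rewrite /W tr_block_mx map_block_mx !trmx0 !map_mx0 trmx1.
  by rewrite (map_mx1 (Num.conj : {rmorphism _ -> _})).
have Wu : W \is unitarymx.
  apply/unitarymxP; rewrite Wadj mulmx_block !(mul0mx, mulmx0, addr0, add0r, mulmx1).
  have -> : U *m U^t* = 1%:M by apply/unitarymxP.
  by rewrite -scalar_mx_block.
have unE (V : lmodType R[i]) k (Q : 'M[R[i]]_k) (Y : tensmx V k) x y :
    unitary_conj Q Y x y = \sum_b Q b y *: \sum_a Num.conj (Q a x) *: Y a b.
  rewrite mxE; apply: eq_bigr => b _; rewrite mxE; congr (_ *: _).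
  by apply: eq_bigr => a _; rewrite !mxE.
have Zll i j : Z (lshift m.+1 i) (lshift m.+1 j) = X i j by rewrite /Z dsumE.
have Zlr i j : Z (lshift m.+1 i) (rshift n j) = 0 by rewrite /Z dsumE.
have Zrl i j : Z (rshift n i) (lshift m.+1 j) = 0 by rewrite /Z dsumE.
have Zrr i j : Z (rshift n i) (rshift n j) = X0 i j by rewrite /Z dsumE.
have ZU : dsum (unitary_conj U X) X0 = unitary_conj W Z.
  apply: tensmx_block_eq => i j; rewrite dsumE [RHS]unE big_split_ord /=.
  - rewrite [X in _ + X]big1 ?addr0 => [|b _]; last by rewrite Wrl scale0r.
    rewrite unE; apply: eq_bigr => b _; rewrite Wll; congr (_ *: _).
    rewrite big_split_ord /= [X in _ + X]big1 ?addr0 => [|a _].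
      by apply: eq_bigr => a _; rewrite Wll Zll.
    by rewrite Wrl rmorph0 scale0r.
  - rewrite big1 => [|b _]; last by rewrite Wlr scale0r.
    rewrite add0r big1 // => b _; rewrite big_split_ord /= !big1 ?addr0 ?scaler0 // => a _.
      by rewrite Wrl rmorph0 scale0r.
    by rewrite Zlr scaler0.
  - rewrite [X in _ + X]big1 ?addr0 => [|b _]; last by rewrite Wrl scale0r.
    rewrite big1 // => b _; rewrite big_split_ord /= !big1 ?addr0 ?scaler0 // => a _.
      by rewrite Zrl scaler0.
    by rewrite Wlr rmorph0 scale0r.
  rewrite big1 => [|b _]; last by rewrite Wlr scale0r.
  rewrite add0r (bigD1 j) //= Wrr eqxx scale1r [X in _ + X]big1 => [|b bj]; last first.
    by rewrite Wrr (negPf bj) scale0r.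
  rewrite addr0 big_split_ord /= big1 => [|a _]; last by rewrite Zlr scaler0.
  rewrite add0r (bigD1 i) //= Wrr eqxx rmorph1 scale1r big1 ?addr0 ?Zrr // => a ai.
  by rewrite Wrr (negPf ai) rmorph0 scale0r.
(* Only the column of [U] at [i] appears, since [W] acts as the identity on the index [o]. *)
have WK i : W *m delta_mx (lshift m.+1 i) (base n) *m W^t* =
    \sum_k U k i *: delta_mx (lshift m.+1 k) (base n).
  apply/matrixP => x y; rewrite mulmx_delta_adj summxE.
  case: (split_ordP x) => k ->; last first.
    rewrite Wrl mul0r big1 // => l _; rewrite !mxE eq_rlshift /= mulr0 //.
  rewrite Wll (bigD1 k) //= big1 => [|l lk]; last first.
    by rewrite !mxE eq_lshift eq_sym (negPf lk) mulr0.
  rewrite addr0 [RHS]mxE [delta_mx _ _ _ _]mxE eqxx /=; congr (_ * _).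
  case: (split_ordP y) => l ->; first by rewrite Wlr rmorph0 eq_lrshift.
  by rewrite Wrr rmorph_nat eq_rshift.
apply/matrixP => j i; rewrite [RHS]unE [LHS]conjugate_partE ZU.
have -> : del_commutator (@u (n + m.+1)) (unitary_conj W Z)
    (delta_mx (lshift m.+1 i) (base n)) =
    unitary_conj W (\sum_k U k i *:
      del_commutator (@u (n + m.+1)) Z (delta_mx (lshift m.+1 k) (base n))).
  rewrite -(del_commutator_sum _ _ _ N0 DZ) -WK /del_commutator.
  by rewrite unitary_conj_commutator // (del_free_unitary oD fu phu).
rewrite unE big_split_ord /= big1 => [|b _]; last by rewrite Wlr scale0r.
rewrite add0r (bigD1 ord0) //= Wrr eqxx scale1r [X in _ + X]big1 => [|b b0]; last first.
  by rewrite Wrr (negPf b0) scale0r.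
rewrite addr0 big_split_ord /= [X in _ + X]big1 => [|a _]; last first.
  by rewrite Wrl rmorph0 scale0r.
rewrite addr0.
under eq_bigr => a _ do rewrite Wll summxE scaler_sumr.
rewrite exchange_big; apply: eq_bigr => k _; rewrite scaler_sumr.
apply: eq_bigr => a _; rewrite conjugate_partE tensmx_scaleE.
by rewrite !scalerA mulrC.
Qed.

Lemma conjugate_unitary {n} (U : 'M[R[i]]_n) (X : tensmx E n) :
  (0 < n)%N -> U \is unitarymx -> D X ->
  conjugate u X0 (unitary_conj U X) = unitary_conj U (conjugate u X0 X).
Proof.
move=> n0 Uu DX.
by rewrite /conjugate conjugate_part_unitary // unitary_conjD unitary_conj_scalar.
Qed.

(** Each entry is [del u y [y, K]] at [y] equal to [X] with [X0] appended, an affine function of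
    [X], plus a constant that cancels in difference quotients. Both the point and the direction
    depend on [X], which calls for [cquot_linear_direction]. *)
Lemma conjugate_analytic n : (0 < n)%N ->
  analytic_on (@D n) (conjugate u X0 (n := n)).
Proof.
move=> n0 X DX; have N0 : (0 < n + m.+1)%N by rewrite addnS.
have DZ := dsum_base fD DX0 n0 DX; have ph := (phu N0).2.
split=> [|v].
  apply: (tensmx_cvg (FG := nbhs_filter X)) => j i.
  pose K : 'M[R[i]]_(n + m.+1) := delta_mx (lshift m.+1 i) (base n).
  have c1 : {for dsum X X0, continuous (fun y => del (@u (n + m.+1)) y (commutator y K))}.
    exact (del_continuous ph.1 DZ (@commutator_continuous _ _ _ K (dsum X X0))).
  have c2 := tensmx_entry_cvg (FG := nbhs_filter _) (i := lshift m.+1 j) (j := base n) c1.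
  have c3 := @cvg_comp _ _ _ (fun X : tensmx E n => dsum X X0) _ _ _ _
    (@dsum_continuous _ _ _ _ X0 X) c2.
  under eq_fun do rewrite conjugateE.
  rewrite conjugateE.
  exact (@tvs_cvgD R A _ _ (nbhs_filter X) _ _ _ _ c3 (cvg_cst _)).
have F0 : Filter ((0 : R[i]^o)^') by exact: dnbhs_filter.
pose K i := delta_mx (lshift m.+1 i) (base n) : 'M[R[i]]_(n + m.+1).
pose G i y := del (@u (n + m.+1)) y (commutator y (K i)).
have h i := cquot_linear_direction (hN _) (oD N0)
  (fun a b => commutatorDl a b (K i)) (fun c a => commutatorZl c a (K i))
  (v := dsum v 0) ph DZ.
exists (\matrix_(j, i) (del2 (@u (n + m.+1)) (dsum X X0)
    (commutator (dsum X X0) (K i)) (dsum v 0)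
  + del (@u (n + m.+1)) (dsum X X0) (commutator (dsum v 0) (K i)))
    (lshift m.+1 j) (base n)).
apply: (tensmx_cvg (FG := F0)) => j i; rewrite [X in _ --> X]mxE.
have hji := tensmx_entry_cvg (FG := F0) (i := lshift m.+1 j) (j := base n) (h i).
have -> // : (fun z : R[i]^o => cquot (conjugate u X0 (n := n)) X v z j i) =
  (fun z : R[i]^o => cquot (G i) (dsum X X0) (dsum v 0) z (lshift m.+1 j) (base n)).
apply/funext => z; rewrite /cquot !tensmx_scaleE; congr (_ *: _).
have subE k (Y Y' : tensmx A k) a b : (Y - Y') a b = Y a b - Y' a b by rewrite !mxE.
refine (etrans (subE _ _ _ _ _) (etrans _ (esym (subE _ _ _ _ _)))).
refine (etrans (congr2 (fun x y : A => x - y) (conjugateE _ _ _ j i) (conjugateE _ _ _ j i)) _).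
have cancel (a b c : A) : a + c - (b + c) = a - b by rewrite opprD addrACA subrr addr0.
have Zv : dsum (X + (z : R[i]) *: v) X0 = dsum X X0 + (z : R[i]) *: dsum v 0.
  by rewrite -dsumZ -dsumD scaler0 addr0.
by rewrite cancel Zv.
Qed.

End ConjugateUnitaryAnalytic.

Theorem corollary2p2 (R : realType) (R1 : topologicalLmodType R[i])
    (A : cstarAlgType R) (B R2 : set A) (D : forall n, set (tensmx R1 n))
    (u : forall n, tensmx R1 n -> tensmx A n) :
  operator_algebra B -> subspace_of R2 -> R2 `<=` B ->
  free_set D -> free_open D -> free_connected D ->
  real_free_function D R2 u -> free_pluriharmonic D u ->
  exists f : forall n, tensmx R1 n -> tensmx A n,
    [/\ real_free_function D (closure R2) f, free_analytic D f
      & forall n (X : tensmx R1 n), (0 < n)%N -> D n X -> u n X = Remx (f n X)].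
Proof.
move=> _ sR2 _ fD oD _ fu phu.
(* The construction needs a base point at some positive level, any one serving all levels; without
   one, every condition on [f] is vacuous. *)
have [[m [X0 DX0]]|noD] := pselect (exists m (X0 : tensmx R1 m.+1), D m.+1 X0).
  exists (fun n => conjugate u X0 (n := n)); split=> [|n n0|n X n0 DX].
  - split=> [n X n0 DX|p q X Y p0 q0 DX DY|n V X n0 Vu DX].
    + exact: (conjugate_closure sR2 fD oD fu phu DX0).
    + exact: (conjugate_dsum fD oD fu phu DX0).
    + exact: (conjugate_unitary fD oD fu phu DX0).
  - exact: (conjugate_analytic fD oD phu DX0).
  - exact: (conjugate_Re fD oD fu phu DX0).
have D0 n (X : tensmx R1 n) : (0 < n)%N -> ~ D n X.
  by case: n X => // n X _ DX; apply: noD; exists n, X.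
exists (fun n _ => 0); split=> [|n n0 X DX|n X n0 DX]; last 2 first.
- by case: (D0 n X n0 DX).
- by case: (D0 n X n0 DX).
split=> [n X n0 DX|p q X Y p0 q0 DX|n V X n0 Vu DX].
- by case: (D0 n X n0 DX).
- by case: (D0 p X p0 DX).
- by case: (D0 n X n0 DX).
Qed.
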